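(* Let $0<q<1$, $0<a<q^{-1}$, $b<q^{-1}$, and let $c\in\mathbb{C}\setminus\{0\}$ be such that $\gamma=(1+abq^2)-(acq+bq/c)$ is real and $\Lambda_n^\gamma:=q^{-n}(1-acq^{n+1})(1-bq^{n+1}/c)>0$ for all $n\in\mathbb{N}$. Let $\nu$ be the measure on $q^{\mathbb{N}}=\{q^k:k\in\mathbb{N}\}$ with $\nu(\{q^k\})=w_k(a,b;q)=\frac{(qb;q)_k}{(q;q)_k}(aq)^k$, and define on functions $f:q^{\mathbb{N}}\to\mathbb{C}$ \[ (T^\gamma f)(x)=aq(bqx-1)\bigl(f(qx)-f(x)\bigr)+(x-1)\bigl(f(q^{-1}x)-f(x)\bigr)+\gamma x f(x),\qquad x\in q^{\mathbb{N}} \] (at $x=1$ the coefficient $x-1$ vanishes). Then $T^\gamma$ is a bounded self-adjoint operator on $L^2(\nu)$ with simple spectrum equal to \[ \bigl[(1-\sqrt{aq})^2,(1+\sqrt{aq})^2\bigr]\ \cup\ \bigl\{(1-q^{-k}/c)(1-acq^{1+k}): k\in\mathbb{N},\ |q^kc\sqrt{aq}|>1\bigr\} \] \[ \cup\ \bigl\{(1-bq^{l+1}/c)(1-acq^{-l}/b): l\in\mathbb{N},\ |q^l\tfrac{b}{c}\sqrt{q/a}|>1\bigr\}. \]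
   Context: $(x;q)_k=\prod_{j=0}^{k-1}(1-xq^j)$, $(x_1,\dots,x_r;q)_k=\prod_i(x_i;q)_k$, $\mathbb{N}=\{0,1,2,\dots\}$. (When $q^kc\sqrt{aq}$ etc. is required to have modulus $>1$, the corresponding parameter is real in the relevant case.) *)

(* Defs.v *)
From Stdlib Require Import Reals Lra List.
Open Scope R_scope.

Definition cplx : Type := (R * R)%type.
Definition RtoC (x : R) : cplx := (x, 0).
Definition c0 : cplx := (0, 0).
Definition c1 : cplx := (1, 0).
Definition cadd (z w : cplx) : cplx := (fst z + fst w, snd z + snd w).
Definition copp (z : cplx) : cplx := (- fst z, - snd z).
Definition csub (z w : cplx) : cplx := cadd z (copp w).
Definition cmul (z w : cplx) : cplx :=
  (fst z * fst w - snd z * snd w, fst z * snd w + snd z * fst w).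
Definition cscal (r : R) (z : cplx) : cplx := (r * fst z, r * snd z).
Definition cnorm2 (z : cplx) : R := fst z ^ 2 + snd z ^ 2.
Definition cmod (z : cplx) : R := sqrt (cnorm2 z).
Definition cconj (z : cplx) : cplx := (fst z, - snd z).
Definition cinv (z : cplx) : cplx := (fst z / cnorm2 z, - snd z / cnorm2 z).

Fixpoint qpoch (x q : R) (k : nat) : R :=
  match k with
  | O => 1
  | S k' => qpoch x q k' * (1 - x * q ^ k')
  end.

Definition weight (a b q : R) (k : nat) : R :=
  qpoch (q * b) q k / qpoch q q k * (a * q) ^ k.

(** Functions on q^N are identified with sequences: f k = f(q^k). *)
Definition seqC : Type := nat -> cplx.

Definition csum (u : nat -> cplx) (z : cplx) : Prop :=
  infinite_sum (fun k => fst (u k)) (fst z) /\ infinite_sum (fun k => snd (u k)) (snd z).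

Definition sqnorm (w : nat -> R) (f : seqC) (s : R) : Prop :=
  infinite_sum (fun k => w k * cnorm2 (f k)) s.

Definition inL2 (w : nat -> R) (f : seqC) : Prop := exists s, sqnorm w f s.

Definition inner (w : nat -> R) (f g : seqC) (z : cplx) : Prop :=
  csum (fun k => cscal (w k) (cmul (f k) (cconj (g k)))) z.

(** The operator T^gamma, x = q^k:
   (Tf)(x) = aq(bqx-1)(f(qx)-f(x)) + (x-1)(f(x/q)-f(x)) + gamma x f(x).
   f(qx) = f (k+1), f(x/q) = f (k-1); at k = 0 the coefficient x-1 vanishes
   (we use pred 0 = 0, which makes the term 0 as well). *)
Definition Tgamma (a b q : R) (gamma : cplx) (f : seqC) : seqC :=
  fun k =>
    let x := q ^ k in
    cadd (cadd (cscal (a * q * (b * q * x - 1)) (csub (f (S k)) (f k)))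
               (cscal (x - 1) (csub (f (pred k)) (f k))))
         (cmul (cscal x gamma) (f k)).

Definition bounded_op (w : nat -> R) (T : seqC -> seqC) : Prop :=
  (forall f, inL2 w f -> inL2 w (T f)) /\
  exists M, 0 <= M /\
    forall f s s', sqnorm w f s -> sqnorm w (T f) s' -> s' <= M * s.

Definition self_adjoint (w : nat -> R) (T : seqC -> seqC) : Prop :=
  forall f g, inL2 w f -> inL2 w g ->
    exists z, inner w (T f) g z /\ inner w f (T g) z.

Definition in_spectrum (w : nat -> R) (T : seqC -> seqC) (lam : cplx) : Prop :=
  let Tl := fun f : seqC => fun k => csub (T f k) (cmul lam (f k)) in
  ~ exists S : seqC -> seqC,
      (forall f, inL2 w f -> inL2 w (S f)) /\
      (exists M, 0 <= M /\
         forall f s s', sqnorm w f s -> sqnorm w (S f) s' -> s' <= M * s) /\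
      (forall f, inL2 w f -> S (Tl f) = f) /\
      (forall f, inL2 w f -> Tl (S f) = f).

Fixpoint polyT (T : seqC -> seqC) (cs : list cplx) (v : seqC) : seqC :=
  match cs with
  | nil => fun _ => c0
  | c :: cs' => fun k => cadd (cmul c (v k)) (polyT T cs' (T v) k)
  end.

Definition simple_spectrum (w : nat -> R) (T : seqC -> seqC) : Prop :=
  exists v, inL2 w v /\
    forall f, inL2 w f -> forall eps, 0 < eps ->
      exists cs s, sqnorm w (fun k => csub (f k) (polyT T cs v k)) s /\ s < eps.

Definition gammaC (a b q : R) (c : cplx) : cplx :=
  csub (RtoC (1 + a * b * q ^ 2)) (cadd (cscal (a * q) c) (cscal (b * q) (cinv c))).

Definition LambdaC (a b q : R) (c : cplx) (n : nat) : cplx :=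
  cscal (/ q ^ n) (cmul (csub c1 (cscal (a * q ^ (S n)) c))
                        (csub c1 (cscal (b * q ^ (S n)) (cinv c)))).

Definition spec_set (a b q : R) (c : cplx) (lam : cplx) : Prop :=
  (snd lam = 0 /\ (1 - sqrt (a * q)) ^ 2 <= fst lam <= (1 + sqrt (a * q)) ^ 2)
  \/ (exists k : nat, cmod (cscal (q ^ k * sqrt (a * q)) c) > 1 /\
        lam = cmul (csub c1 (cscal (/ q ^ k) (cinv c)))
                   (csub c1 (cscal (a * q ^ (S k)) c)))
  \/ (exists l : nat, cmod (cscal (q ^ l * b * sqrt (q / a)) (cinv c)) > 1 /\
        lam = cmul (csub c1 (cscal (b * q ^ (S l)) (cinv c)))
                   (csub c1 (cscal (a / q ^ l / b) c))).

(* Main.v *)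
(* After the rescaling g k = s^k f k with s = sqrt (a q), the operator becomes
   1 + s^2 - s J on l^2, where J is the Jacobi-type operator of the Al-Salam-Chihara
   polynomials with parameters A = c s and B = (b / c) sqrt (q / a).  For
   lambda = 1 + s^2 - s (z + 1/z) with 0 < |z| < 1, the solution of J g = (z + 1/z) g decaying
   like z^k is z^k times a 2phi1 series in q^(k+1).  It satisfies the equation at every k >= 1
   and fails it at k = 0 by a multiple of (Az;q)_oo (Bz;q)_oo.  If this product vanishes, the
   solution is an eigenvector, which gives the two discrete families; otherwise variation of
   parameters yields a bounded inverse.  For |z| = 1, which is the interval, truncated powers
   z^k are approximate eigenvectors.  The unit vector at x = 1 is cyclic because the operator is
   tridiagonal with nonzero off-diagonal entries. *)

Require Import Defs.
From Stdlib Require Import Reals Lra Lia List FunctionalExtensionality Classical.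
From Coquelicot Require Import Coquelicot.
Open Scope R_scope.

(** * Elementary estimates *)


(** The spectrum is decided point by point from one number. [J] is symmetric for the weight
    [omega = (p;q)_k / (q;q)_k], so the [omega]-weighted Wronskian of two solutions is constant.
    Paired with the solution [phi] that starts from 1 at [k = 0], the decaying solution [psi] has as
    Wronskian, up to sign, its own defect [d] at [k = 0], and the kernel of variation of parameters
    is [psi(max) omega phi(min) / d]. Its boundedness rests on the growth bound [phi = O(|z|^-k)], a
    Gronwall argument: the kernel is then [O(|z|^|i-j|)], and convolution with a geometric sequence
    is bounded on [l^2]. Injectivity comes from the same Wronskian, which tends to 0 for a
    square-summable solution paired with the bounded [psi]. Every complex [mu] is [z + 1/z] with
    [0 < |z| <= 1], so non-real [lambda] are covered without appeal to self-adjointness. Since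
    [omega] and its inverse are bounded, all estimates are made in unweighted [l^2]. *)

Lemma gronwall_pow (q K : R) (X : nat -> R) :
  0 < q < 1 -> 0 <= K -> (forall k, 0 <= X k) ->
  (forall k, X (S k) <= (1 + K * q ^ k) * X k) ->
  forall k, X k <= X 0%nat * exp (K / (1 - q)).
Proof.
  intros Hq HK HX Hstep k.
  (* The exponent is the sum of [K * q ^ j] over [j < k], which makes the induction close;
     afterwards it is bounded by the full geometric series. *)
  assert (Hk : X k <= X 0%nat * exp (K * (1 - q ^ k) / (1 - q))).
  { induction k as [|k IH].
    - simpl. replace (K * (1 - 1) / (1 - q)) with 0 by (field; lra).
      rewrite exp_0. lra.
    - apply Rle_trans with (1 := Hstep k).
      apply Rle_trans with (exp (K * q ^ k) * (X 0%nat * exp (K * (1 - q ^ k) / (1 - q)))).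
      + assert (0 <= q ^ k) by (apply pow_le; lra).
        assert (0 <= K * q ^ k) by (apply Rmult_le_pos; lra).
        apply Rmult_le_compat; [lra | apply HX | | exact IH].
        apply exp_ineq1_le.
      + right. rewrite <- Rmult_assoc, (Rmult_comm (exp _) (X 0%nat)), Rmult_assoc, <- exp_plus.
        do 2 f_equal. simpl. field. lra. }
  apply Rle_trans with (1 := Hk).
  apply Rmult_le_compat_l; [apply HX|].
  assert (Hle : K * (1 - q ^ k) / (1 - q) <= K / (1 - q)).
  { unfold Rdiv. apply Rmult_le_compat_r.
    - left; apply Rinv_0_lt_compat; lra.
    - assert (0 <= q ^ k) by (apply pow_le; lra). nra. }
  destruct Hle as [Hlt | ->]; [left; apply exp_increasing; exact Hlt | right; reflexivity].
Qed.

Lemma finite_upper_bound (f : nat -> R) (N : nat) :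
  exists M, forall n, (n < N)%nat -> f n <= M.
Proof.
  induction N as [|N [M HM]].
  - exists 0. intros n Hn. lia.
  - exists (Rmax M (f N)). intros n Hn.
    destruct (Nat.eq_dec n N) as [-> | Hne]; [apply Rmax_r|].
    apply Rle_trans with M; [apply HM; lia | apply Rmax_l].
Qed.

Lemma pow_small (q e : R) : 0 < q < 1 -> 0 < e -> exists N, forall n, (N <= n)%nat -> q ^ n < e.
Proof.
  intros Hq He.
  destruct (pow_lt_1_zero q) with (y := e) as [N HN]; [rewrite Rabs_pos_eq; lra | lra |].
  exists N. intros n Hn. specialize (HN n Hn).
  rewrite Rabs_pos_eq in HN; [lra | apply pow_le; lra].
Qed.

Lemma pow_unit_le (q : R) (n : nat) : 0 < q < 1 -> 0 < q ^ n <= 1.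
Proof.
  intros Hq. split; [apply pow_lt; lra|].
  rewrite <- (pow1 n). apply pow_incr. lra.
Qed.

Lemma Cmod_triangle_inv (x y : C) : Cmod x - Cmod y <= Cmod (x - y)%C.
Proof.
  assert (H := Cmod_triangle (x - y)%C y).
  replace (x - y + y)%C with x in H by ring. lra.
Qed.

Lemma Cmod_minus_le (x y : C) : Cmod (x - y)%C <= Cmod x + Cmod y.
Proof. assert (H := Cmod_triangle x (- y)%C). rewrite Cmod_opp in H. exact H. Qed.

(** * q-Pochhammer products: bounds from above and away from zero *)

Fixpoint cqpoch (x : C) (q : R) (n : nat) : C :=
  match n with
  | O => RtoC 1
  | S n => (cqpoch x q n * (1 - x * RtoC (q ^ n)))%C
  end.

Lemma cqpoch_RtoC (x q : R) (n : nat) : cqpoch (RtoC x) q n = RtoC (qpoch x q n).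
Proof.
  induction n as [|n IH]; [reflexivity|]. simpl.
  rewrite IH, <- RtoC_mult, <- RtoC_minus, <- RtoC_mult. reflexivity.
Qed.

Lemma cqpoch_bounded (x : C) (q : R) :
  0 < q < 1 -> exists M, 0 < M /\ forall n, Cmod (cqpoch x q n) <= M.
Proof.
  intros Hq. exists (exp (Cmod x / (1 - q))). split; [apply exp_pos|]. intros n.
  replace (exp (Cmod x / (1 - q))) with (Cmod (cqpoch x q 0) * exp (Cmod x / (1 - q)))
    by (simpl; rewrite Cmod_1; ring).
  apply (gronwall_pow q (Cmod x) (fun n => Cmod (cqpoch x q n))); try assumption.
  - apply Cmod_ge_0.
  - intros; apply Cmod_ge_0.
  - intros k. simpl. rewrite Cmod_mult, Rmult_comm.
    apply Rmult_le_compat_r; [apply Cmod_ge_0|].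
    apply Rle_trans with (1 := Cmod_minus_le _ _).
    rewrite Cmod_1, Cmod_mult, Cmod_R, Rabs_pos_eq; [lra | apply pow_le; lra].
Qed.

Lemma cqpoch_neq_0 (x : C) (q : R) :
  (forall n, (1 - x * RtoC (q ^ n))%C <> 0%C) -> forall n, cqpoch x q n <> 0%C.
Proof.
  intros H n. induction n as [|n IH]; simpl; [apply C1_nz|].
  apply Cmult_neq_0; [exact IH | apply H].
Qed.

(** A convergent infinite product without a zero factor stays away from 0. Gronwall is applied to
    the inverses: with [u = |1 - x q^n|], the inequality [1 <= u + |x| q^n] gives
    [1/u <= 1 + (|x|/u) q^n], and [1/u] is bounded uniformly in [n]. *)
Lemma cqpoch_lower (x : C) (q : R) :
  0 < q < 1 -> (forall n, (1 - x * RtoC (q ^ n))%C <> 0%C) ->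
  exists m, 0 < m /\ forall n, m <= Cmod (cqpoch x q n).
Proof.
  intros Hq Hx.
  assert (Hx0 := Cmod_ge_0 x).
  assert (HM : exists M, 0 <= M /\ forall n, / Cmod (1 - x * RtoC (q ^ n))%C <= M).
  (* Beyond this threshold [|x| q^n <= 1/2], so the inverse factor is at most 2; only finitely many
     factors remain. *)
  { destruct (pow_small q (/ (2 * (Cmod x + 1)))) as [N HN]; [exact Hq | apply Rinv_0_lt_compat; lra |].
    destruct (finite_upper_bound (fun n => / Cmod (1 - x * RtoC (q ^ n))%C) N) as [M HM].
    exists (Rmax M 2). split; [apply Rle_trans with 2; [lra | apply Rmax_r]|].
    intros n. destruct (Nat.lt_ge_cases n N) as [Hn | Hn].
    - apply Rle_trans with (1 := HM n Hn). apply Rmax_l.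
    - apply Rle_trans with 2; [|apply Rmax_r].
      specialize (HN n Hn).
      assert (Hlow := Cmod_triangle_inv (RtoC 1) (x * RtoC (q ^ n))%C).
      rewrite Cmod_1, Cmod_mult, Cmod_R, Rabs_pos_eq in Hlow by (apply pow_le; lra).
      assert (Hqn : 0 < q ^ n) by (apply pow_lt; lra).
      assert (Hs : Cmod x * q ^ n <= / 2).
      { apply Rle_trans with ((Cmod x + 1) * / (2 * (Cmod x + 1))); [nra|]. right. field. lra. }
      replace 2 with (/ / 2) by field.
      apply Rinv_le_contravar; lra. }
  destruct HM as [M [HM0 HM]].
  exists (/ exp (Cmod x * M / (1 - q))). split; [apply Rinv_0_lt_compat, exp_pos|].
  assert (Hinv : forall n, / Cmod (cqpoch x q n) <= / Cmod (cqpoch x q 0) * exp (Cmod x * M / (1 - q))).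
  { apply (gronwall_pow q (Cmod x * M) (fun n => / Cmod (cqpoch x q n))); try assumption.
    - apply Rmult_le_pos; assumption.
    - intros k. left. apply Rinv_0_lt_compat, Cmod_gt_0, cqpoch_neq_0, Hx.
    - intros k. simpl. rewrite Cmod_mult, Rinv_mult, Rmult_comm.
      apply Rmult_le_compat_r.
      { left. apply Rinv_0_lt_compat, Cmod_gt_0, cqpoch_neq_0, Hx. }
      assert (Hpos : 0 < Cmod (1 - x * RtoC (q ^ k))%C) by (apply Cmod_gt_0, Hx).
      assert (Hqn : 0 < q ^ k) by (apply pow_lt; lra).
      assert (Htri := Cmod_triangle (1 - x * RtoC (q ^ k))%C (x * RtoC (q ^ k))%C).
      replace (1 - x * RtoC (q ^ k) + x * RtoC (q ^ k))%C with (RtoC 1) in Htri by ring.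
      rewrite Cmod_1, (Cmod_mult x), Cmod_R, (Rabs_pos_eq (q ^ k)) in Htri by lra.
      specialize (HM k). set (u := Cmod (1 - x * RtoC (q ^ k))%C) in *.
      assert (Hu : / u * u = 1) by (field; lra).
      assert (Hiu : 0 < / u) by (apply Rinv_0_lt_compat; lra).
      assert (H0 : 0 <= Cmod x * q ^ k) by (apply Rmult_le_pos; lra).
      nra. }
  intros n. specialize (Hinv n). simpl in Hinv. rewrite Cmod_1, Rinv_1, Rmult_1_l in Hinv.
  rewrite <- (Rinv_inv (Cmod (cqpoch x q n))).
  apply Rinv_le_contravar; [|exact Hinv].
  apply Rinv_0_lt_compat, Cmod_gt_0, cqpoch_neq_0, Hx.
Qed.

Lemma qpoch_bounds (x q : R) :
  0 < q < 1 -> x < 1 ->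
  exists m M, 0 < m /\ forall n, m <= qpoch x q n <= M.
Proof.
  intros Hq Hx.
  assert (Hfac : forall n, 0 < 1 - x * q ^ n).
  { intros n. assert (H := pow_unit_le q n Hq). nra. }
  assert (Hpos : forall n, 0 < qpoch x q n).
  { induction n as [|n IH]; simpl; [lra|]. apply Rmult_lt_0_compat; [exact IH | apply Hfac]. }
  destruct (cqpoch_bounded (RtoC x) q Hq) as [M [_ HM]].
  destruct (cqpoch_lower (RtoC x) q Hq) as [m [Hm Hlow]].
  { intros n H. rewrite <- RtoC_mult, <- RtoC_minus in H. apply RtoC_inj in H.
    specialize (Hfac n). lra. }
  exists m, M. split; [exact Hm|]. intros n. specialize (HM n). specialize (Hlow n).
  rewrite cqpoch_RtoC, Cmod_R, Rabs_pos_eq in HM, Hlow by (left; apply Hpos). lra.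
Qed.

(* Convexity of the square, writing [r x + h = r x + (1 - r) (h / (1 - r))]. *)
Lemma sqr_convex_bound (r x y h : R) :
  0 <= r < 1 -> 0 <= y -> y <= r * x + h -> y ^ 2 <= r * x ^ 2 + h ^ 2 / (1 - r).
Proof.
  intros Hr Hy Hle.
  apply Rle_trans with ((r * x + h) ^ 2); [apply pow_incr; lra|].
  apply Rmult_le_reg_r with (1 - r); [lra|].
  replace ((r * x ^ 2 + h ^ 2 / (1 - r)) * (1 - r)) with (r * (1 - r) * x ^ 2 + h ^ 2) by (field; lra).
  assert (0 <= r * ((1 - r) * x - h) ^ 2) by (apply Rmult_le_pos; [lra | apply pow2_ge_0]).
  nra.
Qed.

Lemma sum_f_R0_mult (c : R) (f : nat -> R) (n : nat) :
  sum_f_R0 (fun k => c * f k) n = c * sum_f_R0 f n.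
Proof. rewrite scal_sum. apply sum_eq. intros; ring. Qed.

(** Young's inequality for convolution with [r^k]: squaring the recurrence by convexity and summing
    gives [S <= r S + B / (1 - r)] for the partial sums [S]; [al 0 = 0] removes the initial term. *)
Lemma geometric_convolution_l2 (r B : R) (al h : nat -> R) :
  0 <= r < 1 -> al 0%nat = 0 -> (forall k, 0 <= al k) ->
  (forall k, al (S k) <= r * al k + h k) ->
  (forall n, sum_f_R0 (fun k => h k ^ 2) n <= B) ->
  forall n, sum_f_R0 (fun k => al k ^ 2) n <= B / (1 - r) ^ 2.
Proof.
  intros Hr H0 Hal Hstep HB.
  assert (Hmain : forall n, sum_f_R0 (fun k => al k ^ 2) (S n)
     <= r * sum_f_R0 (fun k => al k ^ 2) n + / (1 - r) * sum_f_R0 (fun k => h k ^ 2) n).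
  { induction n as [|n IH].
    - simpl sum_f_R0. rewrite H0.
      assert (H := sqr_convex_bound r (al 0%nat) (al 1%nat) (h 0%nat) Hr (Hal _) (Hstep 0%nat)).
      rewrite H0 in H. unfold Rdiv in H. simpl in *. lra.
    - rewrite tech5.
      assert (H := sqr_convex_bound r (al (S n)) (al (S (S n))) (h (S n)) Hr (Hal _) (Hstep _)).
      rewrite (tech5 (fun k => h k ^ 2)).
      rewrite (tech5 (fun k => al k ^ 2) n) at 2.
      unfold Rdiv in H. nra. }
  intros n. specialize (Hmain n). rewrite tech5 in Hmain.
  assert (Hsq := pow2_ge_0 (al (S n))).
  assert (Hi : 0 < / (1 - r)) by (apply Rinv_0_lt_compat; lra).
  apply Rmult_le_reg_r with ((1 - r)); [lra|].
  replace (B / (1 - r) ^ 2 * (1 - r)) with (/ (1 - r) * B) by (field; lra).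
  specialize (HB n). nra.
Qed.

(** Run backwards, the recurrence has no initial value: [r^-k] satisfies it with [h = 0]. The a
    priori bound [T] excludes such growth and pays for the last term of the shifted sum. *)
Lemma geometric_tail_l2 (r B T : R) (ta h : nat -> R) :
  0 <= r < 1 -> (forall k, 0 <= ta k) ->
  (forall k, ta k <= r * ta (S k) + h k) ->
  (forall k, ta k ^ 2 <= T) ->
  (forall n, sum_f_R0 (fun k => h k ^ 2) n <= B) ->
  forall n, sum_f_R0 (fun k => ta k ^ 2) n <= (T + B / (1 - r)) / (1 - r).
Proof.
  intros Hr Hta Hstep HT HB n.
  assert (Hmain : forall n, sum_f_R0 (fun k => ta k ^ 2) n
     <= r * (sum_f_R0 (fun k => ta k ^ 2) n - ta 0%nat ^ 2 + ta (S n) ^ 2)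
        + / (1 - r) * sum_f_R0 (fun k => h k ^ 2) n).
  { clear n. induction n as [|n IH].
    - simpl sum_f_R0.
      assert (H := sqr_convex_bound r (ta 1%nat) (ta 0%nat) (h 0%nat) Hr (Hta _) (Hstep 0%nat)).
      unfold Rdiv in H. simpl in *. lra.
    - rewrite !(tech5 _ n).
      assert (H := sqr_convex_bound r (ta (S (S n))) (ta (S n)) (h (S n)) Hr (Hta _) (Hstep _)).
      unfold Rdiv in H. nra. }
  specialize (Hmain n). specialize (HB n).
  assert (Hsq := pow2_ge_0 (ta 0%nat)). assert (HT' := HT (S n)). assert (HT0 := HT 0%nat).
  assert (Hi : 0 < / (1 - r)) by (apply Rinv_0_lt_compat; lra).
  apply Rmult_le_reg_r with (1 - r); [lra|].
  replace ((T + B / (1 - r)) / (1 - r) * (1 - r)) with (T + / (1 - r) * B) by (field; lra).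
  assert (Hb : / (1 - r) * sum_f_R0 (fun k => h k ^ 2) n <= / (1 - r) * B) by (apply Rmult_le_compat_l; lra).
  nra.
Qed.

(** * Complex sequences, series and square summability *)


(** Convergence is stated for the real sequence of distances, so that real squeeze and order lemmas
    apply; [Clim_csum] translates it to the componentwise sums [csum]. *)
Definition Clim (u : nat -> C) (l : C) : Prop := is_lim_seq (fun n => Cmod (u n - l)%C) 0.

Lemma lim_seq_squeeze_0 (u v : nat -> R) :
  (forall n, 0 <= u n <= v n) -> is_lim_seq v 0 -> is_lim_seq u 0.
Proof. intros H Hv. apply is_lim_seq_le_le with (fun _ => 0) v; [exact H | apply is_lim_seq_const | exact Hv]. Qed.

Lemma lim_seq_scal_0 (K : R) (v : nat -> R) : is_lim_seq v 0 -> is_lim_seq (fun n => K * v n) 0.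
Proof.
  intros H. replace (Finite 0) with (Rbar_mult K 0) by (simpl; f_equal; ring).
  apply is_lim_seq_scal_l, H.
Qed.

Lemma lim_seq_plus_0 (u v : nat -> R) :
  is_lim_seq u 0 -> is_lim_seq v 0 -> is_lim_seq (fun n => u n + v n) 0.
Proof. intros Hu Hv. replace 0 with (0 + 0) by ring. apply is_lim_seq_plus'; assumption. Qed.

Lemma Clim_0 (u : nat -> C) : is_lim_seq (fun n => Cmod (u n)) 0 -> Clim u 0%C.
Proof. apply is_lim_seq_ext. intros n. f_equal. ring. Qed.

Lemma Clim_plus (u v : nat -> C) (l m : C) :
  Clim u l -> Clim v m -> Clim (fun n => u n + v n)%C (l + m)%C.
Proof.
  intros Hu Hv. apply lim_seq_squeeze_0 with (2 := lim_seq_plus_0 _ _ Hu Hv).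
  intros n. split; [apply Cmod_ge_0|].
  replace (u n + v n - (l + m))%C with ((u n - l) + (v n - m))%C by ring. apply Cmod_triangle.
Qed.

Lemma Clim_scal (a : C) (u : nat -> C) (l : C) :
  Clim u l -> Clim (fun n => a * u n)%C (a * l)%C.
Proof.
  intros Hu. apply is_lim_seq_ext with (2 := lim_seq_scal_0 (Cmod a) _ Hu).
  intros n. rewrite <- Cmod_mult. f_equal. ring.
Qed.

Lemma Clim_ext (u v : nat -> C) (l : C) : (forall n, u n = v n) -> Clim u l -> Clim v l.
Proof. intros H. apply is_lim_seq_ext. intros n. rewrite H. reflexivity. Qed.

Lemma Clim_minus (u v : nat -> C) (l m : C) :
  Clim u l -> Clim v m -> Clim (fun n => u n - v n)%C (l - m)%C.
Proof.
  intros Hu Hv. assert (H := Clim_plus _ _ _ _ Hu (Clim_scal (- (1))%C _ _ Hv)).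
  replace (l - m)%C with (l + - (1) * m)%C by ring.
  apply Clim_ext with (2 := H). intros; ring.
Qed.

Lemma Clim_const (l : C) : Clim (fun _ => l) l.
Proof.
  apply is_lim_seq_ext with (fun _ => 0); [|apply is_lim_seq_const].
  intros _. replace (l - l)%C with (RtoC 0) by ring. symmetry. apply Cmod_0.
Qed.

Lemma Clim_Cmod_le (u : nat -> C) (l : C) (B : R) :
  (forall n, Cmod (u n) <= B) -> Clim u l -> Cmod l <= B.
Proof.
  intros HB Hl.
  assert (Hlim : is_lim_seq (fun n => B + Cmod (u n - l)%C) B).
  { replace (Finite B) with (Finite (B + 0)) by (f_equal; ring).
    apply is_lim_seq_plus'; [apply is_lim_seq_const | exact Hl]. }
  apply (is_lim_seq_le (fun _ => Cmod l) _ (Cmod l) B) with (3 := Hlim); [|apply is_lim_seq_const].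
  intros n. assert (H := Cmod_triangle (u n) (- (u n - l))%C). rewrite Cmod_opp in H.
  replace (u n + - (u n - l))%C with l in H by ring. specialize (HB n). lra.
Qed.

Lemma Clim_Cmod_ge (u : nat -> C) (l : C) (m : R) :
  (forall n, m <= Cmod (u n)) -> Clim u l -> m <= Cmod l.
Proof.
  intros Hm Hl.
  assert (Hlim : is_lim_seq (fun n => Cmod l + Cmod (u n - l)%C) (Cmod l)).
  { replace (Finite (Cmod l)) with (Finite (Cmod l + 0)) by (f_equal; ring).
    apply is_lim_seq_plus'; [apply is_lim_seq_const | exact Hl]. }
  apply (is_lim_seq_le (fun _ => m) _ m (Cmod l)) with (3 := Hlim); [|apply is_lim_seq_const].
  intros n. assert (H := Cmod_triangle l (u n - l)%C).
  replace (l + (u n - l))%C with (u n) in H by ring. specialize (Hm n). lra.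
Qed.

Lemma Clim_unique (u : nat -> C) (l m : C) : Clim u l -> Clim u m -> l = m.
Proof.
  intros Hl Hm. assert (H := Clim_minus _ _ _ _ Hl Hm).
  apply Ceq_minus, Cmod_eq_0, Rle_antisym; [|apply Cmod_ge_0].
  apply Clim_Cmod_le with (2 := H). intros n.
  replace (u n - u n)%C with (RtoC 0) by ring. rewrite Cmod_0. lra.
Qed.

Definition Csum_n (u : nat -> C) (n : nat) : C :=
  (sum_f_R0 (fun k => fst (u k)) n, sum_f_R0 (fun k => snd (u k)) n).

Definition CSeries (u : nat -> C) : C :=
  (Series (fun k => fst (u k)), Series (fun k => snd (u k))).

Lemma Csum_n_S (u : nat -> C) (n : nat) : Csum_n u (S n) = (Csum_n u n + u (S n))%C.
Proof. reflexivity. Qed.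

Lemma Csum_n_0 (u : nat -> C) : Csum_n u 0 = u 0%nat.
Proof. unfold Csum_n. simpl. symmetry. apply surjective_pairing. Qed.

Lemma Cmod_fst_snd_le (z : C) : Rabs (fst z) <= Cmod z /\ Rabs (snd z) <= Cmod z.
Proof.
  assert (H := Rmax_Cmod z). split; apply Rle_trans with (2 := H); [apply Rmax_l | apply Rmax_r].
Qed.

Lemma Cmod_le_fst_snd (z : C) : Cmod z <= Rabs (fst z) + Rabs (snd z).
Proof.
  replace z with (RtoC (fst z) + Ci * RtoC (snd z))%C at 1.
  - apply Rle_trans with (1 := Cmod_triangle _ _). rewrite Cmod_mult, Cmod_Ci, !Cmod_R. lra.
  - destruct z as [x y]. unfold Ci, RtoC, Cmult, Cplus. simpl. f_equal; ring.
Qed.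

Lemma Clim_components (u : nat -> C) (l : C) :
  is_lim_seq (fun n => fst (u n)) (fst l) -> is_lim_seq (fun n => snd (u n)) (snd l) -> Clim u l.
Proof.
  intros H1 H2.
  assert (H1' : is_lim_seq (fun n => Rabs (fst (u n) - fst l)) 0).
  { apply (proj1 (is_lim_seq_abs_0 _)). replace 0 with (fst l - fst l) by ring.
    apply is_lim_seq_minus'; [exact H1 | apply is_lim_seq_const]. }
  assert (H2' : is_lim_seq (fun n => Rabs (snd (u n) - snd l)) 0).
  { apply (proj1 (is_lim_seq_abs_0 _)). replace 0 with (snd l - snd l) by ring.
    apply is_lim_seq_minus'; [exact H2 | apply is_lim_seq_const]. }
  apply lim_seq_squeeze_0 with (2 := lim_seq_plus_0 _ _ H1' H2').
  intros n. split; [apply Cmod_ge_0 | apply (Cmod_le_fst_snd (u n - l)%C)].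
Qed.

Lemma Clim_fst_snd (u : nat -> C) (l : C) :
  Clim u l -> is_lim_seq (fun n => fst (u n)) (fst l) /\ is_lim_seq (fun n => snd (u n)) (snd l).
Proof.
  intros H. split.
  - assert (H1 : is_lim_seq (fun n => fst (u n) - fst l) 0).
    { apply (proj2 (is_lim_seq_abs_0 _)). apply lim_seq_squeeze_0 with (2 := H).
      intros n. split; [apply Rabs_pos | apply (Cmod_fst_snd_le (u n - l)%C)]. }
    replace (Finite (fst l)) with (Finite (0 + fst l)) by (f_equal; ring).
    apply is_lim_seq_ext with (fun n => fst (u n) - fst l + fst l); [intros; ring|].
    apply is_lim_seq_plus'; [exact H1 | apply is_lim_seq_const].
  - assert (H1 : is_lim_seq (fun n => snd (u n) - snd l) 0).
    { apply (proj2 (is_lim_seq_abs_0 _)). apply lim_seq_squeeze_0 with (2 := H).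
      intros n. split; [apply Rabs_pos | apply (Cmod_fst_snd_le (u n - l)%C)]. }
    replace (Finite (snd l)) with (Finite (0 + snd l)) by (f_equal; ring).
    apply is_lim_seq_ext with (fun n => snd (u n) - snd l + snd l); [intros; ring|].
    apply is_lim_seq_plus'; [exact H1 | apply is_lim_seq_const].
Qed.

Lemma Clim_csum (u : nat -> C) (z : C) : Clim (Csum_n u) z <-> csum u z.
Proof.
  split.
  - intros H. apply Clim_fst_snd in H. destruct H as [H1 H2].
    split; apply is_lim_seq_Reals; assumption.
  - intros [H1 H2]. apply Clim_components; apply is_lim_seq_Reals; assumption.
Qed.

Lemma ex_series_bounded (v : nat -> R) (B : R) :
  (forall k, 0 <= v k) -> (forall n, sum_f_R0 v n <= B) -> ex_series v /\ Series v <= B.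
Proof.
  intros Hv HB.
  assert (Hex : ex_finite_lim_seq (sum_f_R0 v)).
  { apply ex_finite_lim_seq_incr with B; [|exact HB].
    intros n. simpl. specialize (Hv (S n)). lra. }
  destruct Hex as [l Hl].
  assert (Hs : is_series v l) by (apply is_series_Reals, is_lim_seq_Reals, Hl).
  split; [exists l; exact Hs|].
  rewrite (is_series_unique _ _ Hs).
  apply (is_lim_seq_le (sum_f_R0 v) (fun _ => B) l B); [exact HB | exact Hl | apply is_lim_seq_const].
Qed.

Lemma ex_series_components (u : nat -> C) (B : R) :
  (forall n, sum_f_R0 (fun k => Cmod (u k)) n <= B) ->
  ex_series (fun k => fst (u k)) /\ ex_series (fun k => snd (u k)).
Proof.
  intros HB. destruct (ex_series_bounded (fun k => Cmod (u k)) B) as [Hex _];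
    [intros; apply Cmod_ge_0 | exact HB |].
  split; apply (@ex_series_le R_AbsRing R_CompleteNormedModule) with (2 := Hex);
    intros n; apply (Cmod_fst_snd_le (u n)).
Qed.

Lemma CSeries_correct (u : nat -> C) (B : R) :
  (forall n, sum_f_R0 (fun k => Cmod (u k)) n <= B) -> Clim (Csum_n u) (CSeries u).
Proof.
  intros HB. destruct (ex_series_components u B HB) as [H1 H2].
  apply Clim_csum. split; apply is_series_Reals, Series_correct; assumption.
Qed.

Lemma Cmod_Csum_n_le (u : nat -> C) (n : nat) : Cmod (Csum_n u n) <= sum_f_R0 (fun k => Cmod (u k)) n.
Proof.
  induction n as [|n IH]; [rewrite Csum_n_0; simpl; lra|].
  rewrite Csum_n_S, tech5. apply Rle_trans with (1 := Cmod_triangle _ _). lra.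
Qed.

Lemma Cmod_CSeries_le (u : nat -> C) (B : R) :
  (forall n, sum_f_R0 (fun k => Cmod (u k)) n <= B) -> Cmod (CSeries u) <= B.
Proof.
  intros HB. apply Clim_Cmod_le with (2 := CSeries_correct u B HB).
  intros n. apply Rle_trans with (2 := HB n). apply Cmod_Csum_n_le.
Qed.

Lemma CSeries_incr_1 (u : nat -> C) (B : R) :
  (forall n, sum_f_R0 (fun k => Cmod (u k)) n <= B) ->
  CSeries u = (u 0%nat + CSeries (fun k => u (S k)))%C.
Proof.
  intros HB. destruct (ex_series_components u B HB) as [H1 H2].
  unfold CSeries. rewrite (Series_incr_1 _ H1), (Series_incr_1 _ H2). reflexivity.
Qed.

Lemma geometric_sum_bound (r K : R) (v : nat -> R) :
  0 <= r < 1 -> 0 <= K -> (forall n, v n <= K * r ^ n) -> forall n, sum_f_R0 v n <= K / (1 - r).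
Proof.
  intros Hr HK Hv n.
  apply Rle_trans with (sum_f_R0 (fun k => K * r ^ k) n).
  { apply sum_Rle. intros; apply Hv. }
  rewrite sum_f_R0_mult, tech3 by lra. unfold Rdiv.
  apply Rmult_le_compat_l; [exact HK|].
  assert (0 <= r ^ S n) by (apply pow_le; lra).
  assert (0 < / (1 - r)) by (apply Rinv_0_lt_compat; lra). nra.
Qed.

(** A bound on all partial sums in place of a norm: constants pass through sums, shifts and kernels
    without a convergence proof each time. [ex_series_bounded] yields a convergent series where
    [sqnorm] asks for one. *)
Definition l2le (g : nat -> C) (B : R) : Prop :=
  forall n, sum_f_R0 (fun k => Cmod (g k) ^ 2) n <= B.

Lemma l2le_nonneg (g : nat -> C) (B : R) : l2le g B -> 0 <= B.
Proof. intros H. specialize (H 0%nat). simpl in H. assert (H1 := pow2_ge_0 (Cmod (g 0%nat))). simpl in H1. lra. Qed.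

Lemma l2le_point (g : nat -> C) (B : R) (k : nat) : l2le g B -> Cmod (g k) ^ 2 <= B.
Proof.
  intros H. apply Rle_trans with (2 := H k).
  destruct k as [|k]; [simpl; lra|]. rewrite tech5.
  assert (0 <= sum_f_R0 (fun k => Cmod (g k) ^ 2) k) by (apply cond_pos_sum; intros; apply pow2_ge_0).
  lra.
Qed.

Lemma l2le_dominated (g h : nat -> C) (K B : R) :
  0 <= K -> (forall k, Cmod (h k) <= K * Cmod (g k)) -> l2le g B -> l2le h (K ^ 2 * B).
Proof.
  intros HK Hle Hg n.
  apply Rle_trans with (sum_f_R0 (fun k => K ^ 2 * Cmod (g k) ^ 2) n).
  - apply sum_Rle. intros k _. rewrite <- Rpow_mult_distr.
    apply pow_incr. split; [apply Cmod_ge_0 | apply Hle].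
  - rewrite sum_f_R0_mult. apply Rmult_le_compat_l; [apply pow2_ge_0 | apply Hg].
Qed.

Lemma l2le_plus (g h : nat -> C) (B B' : R) :
  l2le g B -> l2le h B' -> l2le (fun k => g k + h k)%C (2 * B + 2 * B').
Proof.
  intros Hg Hh n.
  apply Rle_trans with (sum_f_R0 (fun k => 2 * Cmod (g k) ^ 2 + 2 * Cmod (h k) ^ 2) n).
  - apply sum_Rle. intros k _.
    apply Rle_trans with ((Cmod (g k) + Cmod (h k)) ^ 2).
    + apply pow_incr. split; [apply Cmod_ge_0 | apply Cmod_triangle].
    + assert (H := pow2_ge_0 (Cmod (g k) - Cmod (h k))). nra.
  - rewrite plus_sum, !sum_f_R0_mult. specialize (Hg n). specialize (Hh n). lra.
Qed.

Lemma l2le_shift (g : nat -> C) (B : R) : l2le g B -> l2le (fun k => g (S k)) B.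
Proof.
  intros Hg n. apply Rle_trans with (2 := Hg (S n)).
  rewrite (decomp_sum _ (S n)) by lia. simpl pred. cbv beta.
  assert (H := pow2_ge_0 (Cmod (g 0%nat))). lra.
Qed.

(** The factor 2 is there because [pred 0 = 0] makes [g 0] count twice. *)
Lemma l2le_pred (g : nat -> C) (B : R) : l2le g B -> l2le (fun k => g (pred k)) (2 * B).
Proof.
  intros Hg n. assert (H0 := l2le_point g B 0%nat Hg). assert (HB := l2le_nonneg g B Hg).
  destruct n as [|n]; [simpl in *; lra|].
  rewrite decomp_sum by lia. simpl pred. cbv beta. specialize (Hg n). lra.
Qed.

Lemma l2le_ext (g h : nat -> C) (B : R) : (forall k, g k = h k) -> l2le g B -> l2le h B.
Proof.
  intros H Hg n. rewrite <- (sum_eq (fun k => Cmod (g k) ^ 2)); [apply Hg|].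
  intros i _. rewrite H. reflexivity.
Qed.

Lemma l2le_lim_0 (g : nat -> C) (B : R) : l2le g B -> is_lim_seq (fun k => Cmod (g k)) 0.
Proof.
  intros Hg.
  destruct (ex_series_bounded (fun k => Cmod (g k) ^ 2) B) as [Hex _];
    [intros; apply pow2_ge_0 | exact Hg |].
  assert (H := ex_series_lim_0 _ Hex).
  apply is_lim_seq_ext with (fun k => sqrt (Cmod (g k) ^ 2)).
  - intros k. apply sqrt_pow2, Cmod_ge_0.
  - rewrite <- sqrt_0. apply (is_lim_seq_continuous sqrt _ 0); [|exact H].
    apply continuity_pt_sqrt. lra.
Qed.

Lemma l2le_geometric (g : nat -> C) (K r : R) :
  0 <= r < 1 -> (forall k, Cmod (g k) <= K * r ^ k) -> l2le g (K ^ 2 / (1 - r ^ 2)).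
Proof.
  intros Hr Hg n.
  apply geometric_sum_bound; [nra | apply pow2_ge_0 |].
  intros k. rewrite <- pow_mult, Nat.mul_comm, pow_mult, <- Rpow_mult_distr.
  apply pow_incr. split; [apply Cmod_ge_0 | apply Hg].
Qed.

(** * The decaying solution *)


(* At [k = 0] the coefficient [1 - q ^ k] vanishes, so the value [g (pred 0)] is irrelevant. *)
Definition Jop (q p : R) (sg : C) (g : nat -> C) (k : nat) : C :=
  (RtoC (1 - p * q ^ k) * g (S k) + RtoC (1 - q ^ k) * g (pred k) + sg * RtoC (q ^ k) * g k)%C.

(** Coefficients of [2phi1(A z, B z; q z^2; q, x)]. In [jost_term] the argument is [x = q^(k+1)], so
    the series converges geometrically already at [k = 0]. *)
Definition jost_coeff (q : R) (A B z : C) (n : nat) : C :=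
  (cqpoch (A * z) q n * cqpoch (B * z) q n
   / (cqpoch (RtoC q) q n * cqpoch (RtoC q * (z * z)) q n))%C.

Definition jost_term (q : R) (A B z : C) (k n : nat) : C :=
  (jost_coeff q A B z n * RtoC ((q ^ S k) ^ n))%C.

Definition jost (q : R) (A B z : C) (k : nat) : C :=
  (z ^ k * CSeries (jost_term q A B z k))%C.

Lemma Cminus_mult_neq_0 (x : C) (r : R) : Cmod x < 1 -> 0 <= r <= 1 -> (1 - x * RtoC r)%C <> 0%C.
Proof.
  intros Hx Hr H. apply Cmod_gt_0 with (x := (1 - x * RtoC r)%C); [|exact H].
  assert (Hl := Cmod_triangle_inv (RtoC 1) (x * RtoC r)%C).
  rewrite Cmod_1, Cmod_mult, Cmod_R, Rabs_pos_eq in Hl by lra.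
  assert (H0 := Cmod_ge_0 x). nra.
Qed.

Lemma Cmod_qzz_lt_1 (q : R) (z : C) : 0 < q < 1 -> Cmod z < 1 -> Cmod (RtoC q * (z * z))%C < 1.
Proof.
  intros Hq Hz. rewrite !Cmod_mult, Cmod_R, Rabs_pos_eq by lra.
  assert (H := Cmod_ge_0 z). nra.
Qed.

Lemma jost_denominators_neq_0 (q : R) (z : C) (n : nat) :
  0 < q < 1 -> Cmod z < 1 ->
  (1 - RtoC q * RtoC (q ^ n))%C <> 0%C /\ (1 - RtoC q * (z * z) * RtoC (q ^ n))%C <> 0%C.
Proof.
  intros Hq Hz. assert (Hn := pow_unit_le q n Hq).
  split; apply Cminus_mult_neq_0; try lra.
  - rewrite Cmod_R, Rabs_pos_eq; lra.
  - apply Cmod_qzz_lt_1; assumption.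
Qed.

Lemma jost_coeff_S (q : R) (A B z : C) (n : nat) :
  0 < q < 1 -> Cmod z < 1 ->
  (jost_coeff q A B z (S n) * (1 - RtoC (q ^ S n)) * (1 - z * z * RtoC (q ^ S n)))%C
  = (jost_coeff q A B z n * (1 - A * z * RtoC (q ^ n)) * (1 - B * z * RtoC (q ^ n)))%C.
Proof.
  intros Hq Hz. unfold jost_coeff. simpl cqpoch. simpl pow. rewrite RtoC_mult.
  destruct (jost_denominators_neq_0 q z n Hq Hz) as [H1 H2].
  assert (H3 : cqpoch (RtoC q) q n <> 0%C).
  { apply cqpoch_neq_0. intros m. apply (jost_denominators_neq_0 q z m Hq Hz). }
  assert (H4 : cqpoch (RtoC q * (z * z)) q n <> 0%C).
  { apply cqpoch_neq_0. intros m. apply (jost_denominators_neq_0 q z m Hq Hz). }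
  field. repeat split; assumption.
Qed.

Lemma jost_coeff_bounded (q : R) (A B z : C) :
  0 < q < 1 -> Cmod z < 1 -> exists D, 0 < D /\ forall n, Cmod (jost_coeff q A B z n) <= D.
Proof.
  intros Hq Hz.
  destruct (cqpoch_bounded (A * z)%C q Hq) as [M1 [HM1 H1]].
  destruct (cqpoch_bounded (B * z)%C q Hq) as [M2 [HM2 H2]].
  destruct (cqpoch_lower (RtoC q) q Hq) as [m3 [Hm3 H3]].
  { intros m. apply (jost_denominators_neq_0 q z m Hq Hz). }
  destruct (cqpoch_lower (RtoC q * (z * z))%C q Hq) as [m4 [Hm4 H4]].
  { intros m. apply (jost_denominators_neq_0 q z m Hq Hz). }
  exists (M1 * M2 * / (m3 * m4)).
  assert (Hm : 0 < m3 * m4) by (apply Rmult_lt_0_compat; assumption).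
  split.
  { apply Rmult_lt_0_compat; [apply Rmult_lt_0_compat; assumption | apply Rinv_0_lt_compat, Hm]. }
  intros n. specialize (H1 n). specialize (H2 n). specialize (H3 n). specialize (H4 n).
  unfold jost_coeff. rewrite Cmod_div.
  2:{ apply Cmult_neq_0; apply Cmod_gt_0; lra. }
  rewrite !Cmod_mult. unfold Rdiv. apply Rmult_le_compat.
  - apply Rmult_le_pos; apply Cmod_ge_0.
  - left. apply Rinv_0_lt_compat. apply Rmult_lt_0_compat; lra.
  - apply Rmult_le_compat; try apply Cmod_ge_0; assumption.
  - apply Rinv_le_contravar; [exact Hm|]. apply Rmult_le_compat; lra.
Qed.

Lemma jost_coeff_lower (q : R) (A B z : C) :
  0 < q < 1 -> Cmod z < 1 ->
  (forall n, (1 - A * z * RtoC (q ^ n))%C <> 0%C) ->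
  (forall n, (1 - B * z * RtoC (q ^ n))%C <> 0%C) ->
  exists m, 0 < m /\ forall n, m <= Cmod (jost_coeff q A B z n).
Proof.
  intros Hq Hz HA HB.
  destruct (cqpoch_lower (A * z)%C q Hq HA) as [m1 [Hm1 H1]].
  destruct (cqpoch_lower (B * z)%C q Hq HB) as [m2 [Hm2 H2]].
  destruct (cqpoch_bounded (RtoC q) q Hq) as [M3 [HM3 H3]].
  destruct (cqpoch_bounded (RtoC q * (z * z))%C q Hq) as [M4 [HM4 H4]].
  assert (N3 : forall n, cqpoch (RtoC q) q n <> 0%C).
  { apply cqpoch_neq_0. intros m. apply (jost_denominators_neq_0 q z m Hq Hz). }
  assert (N4 : forall n, cqpoch (RtoC q * (z * z)) q n <> 0%C).
  { apply cqpoch_neq_0. intros m. apply (jost_denominators_neq_0 q z m Hq Hz). }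
  assert (HM : 0 < M3 * M4) by (apply Rmult_lt_0_compat; assumption).
  exists (m1 * m2 * / (M3 * M4)). split.
  { apply Rmult_lt_0_compat; [apply Rmult_lt_0_compat; assumption | apply Rinv_0_lt_compat, HM]. }
  intros n. specialize (H1 n). specialize (H2 n). specialize (H3 n). specialize (H4 n).
  unfold jost_coeff. rewrite Cmod_div by (apply Cmult_neq_0; [apply N3 | apply N4]).
  rewrite !Cmod_mult. unfold Rdiv.
  assert (P3 := proj1 (Cmod_gt_0 _) (N3 n)). assert (P4 := proj1 (Cmod_gt_0 _) (N4 n)).
  apply Rmult_le_compat.
  - apply Rmult_le_pos; lra.
  - left. apply Rinv_0_lt_compat, HM.
  - apply Rmult_le_compat; lra.
  - apply Rinv_le_contravar; [apply Rmult_lt_0_compat; lra|]. apply Rmult_le_compat; lra.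
Qed.

(* Inserting the truncated power series into the difference equation, the coefficient
   recurrence makes everything telescope to the single boundary term on the right. *)
Lemma jost_partial_sums (q p : R) (A B z : C) (N k : nat) :
  0 < q < 1 -> z <> 0%C -> Cmod z < 1 -> (A * B)%C = RtoC p ->
  (RtoC (1 - p * q ^ k) * z * Csum_n (jost_term q A B z (S k)) N
   + RtoC (1 - q ^ k) * / z * Csum_n (jost_term q A B z (pred k)) N
   + ((A + B) * RtoC (q ^ k) - (z + / z)) * Csum_n (jost_term q A B z k) N)%C
  = (- (jost_coeff q A B z (S N) * RtoC ((q ^ k) ^ S N) * / z
        * (1 - RtoC (q ^ S N)) * (1 - z * z * RtoC (q ^ S N))))%C.
Proof.
  intros Hq Hz0 Hz Hp.
  (* The argument [q ^ S (pred k)] is [q ^ k] only for [k >= 1]; at [k = 0] the factor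
     [1 - q ^ 0 = 0] hides the discrepancy. *)
  assert (Hpred : forall n, (RtoC (1 - q ^ k) * RtoC ((q ^ S (pred k)) ^ n))%C
                            = (RtoC (1 - q ^ k) * RtoC ((q ^ k) ^ n))%C).
  { intros n. destruct k as [|k]; [|reflexivity].
    replace (RtoC (1 - q ^ 0)) with (RtoC 0) by (f_equal; simpl; ring). ring. }
  assert (Hrhs : forall n, (jost_coeff q A B z (S n) * RtoC ((q ^ k) ^ S n) * / z
        * (1 - RtoC (q ^ S n)) * (1 - z * z * RtoC (q ^ S n)))%C
      = (RtoC ((q ^ k) ^ n) * RtoC (q ^ k) * / z
         * (jost_coeff q A B z n * (1 - A * z * RtoC (q ^ n)) * (1 - B * z * RtoC (q ^ n))))%C).
  { intros n. rewrite <- (jost_coeff_S q A B z n Hq Hz).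
    rewrite <- (tech_pow_Rmult (q ^ k) n), RtoC_mult. ring. }
  induction N as [|N IH].
  - rewrite Hrhs, !Csum_n_0. unfold jost_term. rewrite !pow_O.
    replace (jost_coeff q A B z 0) with (RtoC 1)
      by (unfold jost_coeff; simpl; field; apply C1_nz).
    rewrite !RtoC_minus, RtoC_mult, <- Hp. field. exact Hz0.
  - rewrite Hrhs, !Csum_n_S.
    assert (Hterm : (RtoC (1 - p * q ^ k) * z * jost_term q A B z (S k) (S N)
      + RtoC (1 - q ^ k) * / z * jost_term q A B z (pred k) (S N)
      + ((A + B) * RtoC (q ^ k) - (z + / z)) * jost_term q A B z k (S N))%C
      = (jost_coeff q A B z (S N) * RtoC ((q ^ k) ^ S N) * / z
          * (1 - RtoC (q ^ S N)) * (1 - z * z * RtoC (q ^ S N))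
        - RtoC ((q ^ k) ^ S N) * RtoC (q ^ k) * / z
         * (jost_coeff q A B z (S N) * (1 - A * z * RtoC (q ^ S N)) * (1 - B * z * RtoC (q ^ S N))))%C).
    { unfold jost_term.
      replace (RtoC (1 - q ^ k) * / z * (jost_coeff q A B z (S N) * RtoC ((q ^ S (pred k)) ^ S N)))%C
        with (/ z * jost_coeff q A B z (S N) * (RtoC (1 - q ^ k) * RtoC ((q ^ S (pred k)) ^ S N)))%C by ring.
      rewrite Hpred.
      replace ((q ^ S (S k)) ^ S N) with ((q ^ k) ^ S N * q ^ S N * q ^ S N)
        by (rewrite <- !Rpow_mult_distr; f_equal; simpl; ring).
      replace ((q ^ S k) ^ S N) with ((q ^ k) ^ S N * q ^ S N)
        by (rewrite <- !Rpow_mult_distr; f_equal; simpl; ring).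
      rewrite !RtoC_minus, !RtoC_mult, <- Hp.
      generalize (RtoC ((q ^ k) ^ S N)) (RtoC (q ^ S N)) (RtoC (q ^ k)) (jost_coeff q A B z (S N)).
      intros X Q x d. field. exact Hz0. }
    transitivity ((RtoC (1 - p * q ^ k) * z * Csum_n (jost_term q A B z (S k)) N
      + RtoC (1 - q ^ k) * / z * Csum_n (jost_term q A B z (pred k)) N
      + ((A + B) * RtoC (q ^ k) - (z + / z)) * Csum_n (jost_term q A B z k) N)
      + (RtoC (1 - p * q ^ k) * z * jost_term q A B z (S k) (S N)
      + RtoC (1 - q ^ k) * / z * jost_term q A B z (pred k) (S N)
      + ((A + B) * RtoC (q ^ k) - (z + / z)) * jost_term q A B z k (S N)))%C; [ring|].
    rewrite IH, Hterm. ring.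
Qed.

Lemma jost_term_sum_bound (q D : R) (A B z : C) (k : nat) :
  0 < q < 1 -> 0 < D -> (forall n, Cmod (jost_coeff q A B z n) <= D) ->
  forall n, sum_f_R0 (fun n => Cmod (jost_term q A B z k n)) n <= D / (1 - q).
Proof.
  intros Hq HD0 HD. apply geometric_sum_bound; [lra | lra |].
  intros n. unfold jost_term.
  assert (H0 := pow_unit_le q k Hq).
  assert (H1 : (q ^ S k) ^ n <= q ^ n) by (apply pow_incr; simpl; nra).
  assert (H2 : 0 <= (q ^ S k) ^ n) by (apply pow_le, pow_le; lra).
  rewrite Cmod_mult, Cmod_R, Rabs_pos_eq by exact H2.
  apply Rmult_le_compat; [apply Cmod_ge_0 | exact H2 | apply HD | exact H1].
Qed.

(** The error of the full series is the limit of the telescoped boundary terms. Two cases arise: the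
    factor [(q ^ k) ^ (N+1)] tends to 0 for [k >= 1], which gives the equation there, but is 1 for
    [k = 0]. *)
Lemma Clim_jost_residual (q p : R) (A B z : C) (k : nat) :
  0 < q < 1 -> z <> 0%C -> Cmod z < 1 -> (A * B)%C = RtoC p ->
  Clim (fun N => - (z ^ k * (jost_coeff q A B z (S N) * RtoC ((q ^ k) ^ S N) * / z
        * (1 - RtoC (q ^ S N)) * (1 - z * z * RtoC (q ^ S N)))))%C
    (Jop q p (A + B)%C (jost q A B z) k - (z + / z) * jost q A B z k)%C.
Proof.
  intros Hq Hz0 Hz Hp.
  destruct (jost_coeff_bounded q A B z Hq Hz) as [D [HD0 HD]].
  assert (HL : forall k, Clim (Csum_n (jost_term q A B z k)) (CSeries (jost_term q A B z k))).
  { intros j. apply CSeries_correct with (D / (1 - q)). apply jost_term_sum_bound; assumption. }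
  assert (Heq : (Jop q p (A + B)%C (jost q A B z) k - (z + / z) * jost q A B z k)%C
    = (z ^ k * (RtoC (1 - p * q ^ k) * z * CSeries (jost_term q A B z (S k))
   + RtoC (1 - q ^ k) * / z * CSeries (jost_term q A B z (pred k))
   + ((A + B) * RtoC (q ^ k) - (z + / z)) * CSeries (jost_term q A B z k)))%C).
  { unfold Jop, jost. destruct k as [|k].
    - simpl pred. simpl pow. simpl Cpow. replace (1 - 1) with 0 by ring. ring.
    - simpl pred. rewrite !Cpow_S. field. exact Hz0. }
  rewrite Heq.
  apply Clim_ext with (fun N => z ^ k * (RtoC (1 - p * q ^ k) * z * Csum_n (jost_term q A B z (S k)) N
   + RtoC (1 - q ^ k) * / z * Csum_n (jost_term q A B z (pred k)) N
   + ((A + B) * RtoC (q ^ k) - (z + / z)) * Csum_n (jost_term q A B z k) N))%C.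
  { intros N. rewrite (jost_partial_sums q p A B z N k Hq Hz0 Hz Hp). ring. }
  apply Clim_scal. repeat apply Clim_plus; apply Clim_scal; apply HL.
Qed.

Lemma jost_equation (q p : R) (A B z : C) (k : nat) :
  0 < q < 1 -> z <> 0%C -> Cmod z < 1 -> (A * B)%C = RtoC p ->
  Jop q p (A + B)%C (jost q A B z) (S k) = ((z + / z) * jost q A B z (S k))%C.
Proof.
  intros Hq Hz0 Hz Hp. apply Ceq_minus.
  apply Clim_unique with (1 := Clim_jost_residual q p A B z (S k) Hq Hz0 Hz Hp).
  destruct (jost_coeff_bounded q A B z Hq Hz) as [D [HD0 HD]].
  apply Clim_0.
  assert (Hlim : is_lim_seq (fun N => (Cmod (z ^ S k) * D * Cmod (/ z) * 2) * q ^ N) 0).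
  { apply lim_seq_scal_0. apply is_lim_seq_geom. rewrite Rabs_pos_eq; lra. }
  apply lim_seq_squeeze_0 with (2 := Hlim). intros N.
  split; [apply Cmod_ge_0|].
  rewrite Cmod_opp, !Cmod_mult, (Cmod_R ((q ^ S k) ^ S N)).
  assert (H0 := pow_unit_le q k Hq). assert (HN := pow_unit_le q N Hq).
  assert (HSN := pow_unit_le q (S N) Hq).
  assert (H1 : (q ^ S k) ^ S N <= q ^ N).
  { apply Rle_trans with (q ^ S N); [apply pow_incr; simpl; nra | simpl; nra]. }
  assert (H2 : 0 <= (q ^ S k) ^ S N) by (apply pow_le, pow_le; lra).
  rewrite Rabs_pos_eq by exact H2.
  assert (H3 : Cmod (1 - RtoC (q ^ S N))%C <= 1).
  { rewrite <- RtoC_minus, Cmod_R, Rabs_pos_eq; lra. }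
  assert (H4 : Cmod (1 - z * z * RtoC (q ^ S N))%C <= 2).
  { apply Rle_trans with (1 := Cmod_minus_le _ _).
    rewrite Cmod_1, !Cmod_mult, Cmod_R, Rabs_pos_eq by lra.
    assert (Hz' := Cmod_ge_0 z).
    assert (Cmod z * Cmod z <= 1) by nra. nra. }
  rewrite !Rmult_assoc. apply Rmult_le_compat_l; [apply Cmod_ge_0|].
  replace (D * (Cmod (/ z) * (2 * q ^ N))) with (D * (q ^ N * (Cmod (/ z) * (1 * 2)))) by ring.
  revert H1 H2. generalize ((q ^ S k) ^ S N). intros y H1 H2.
  repeat (apply Rmult_le_compat; repeat apply Rmult_le_pos; try apply Cmod_ge_0; try lra); auto.
Qed.

(** At [k = 0] the residuals tend to [-(Az, Bz; q)_oo / (z (q, q z^2; q)_oo)]. The infinite products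
    are never formed: either all coefficients stay above a positive bound, or they vanish from some
    index on. *)
Lemma jost_boundary_zero (q p : R) (A B z : C) :
  0 < q < 1 -> z <> 0%C -> Cmod z < 1 -> (A * B)%C = RtoC p ->
  (Jop q p (A + B)%C (jost q A B z) 0 - (z + / z) * jost q A B z 0)%C = 0%C <->
  exists n, (1 - A * z * RtoC (q ^ n))%C = 0%C \/ (1 - B * z * RtoC (q ^ n))%C = 0%C.
Proof.
  intros Hq Hz0 Hz Hp.
  assert (HL := Clim_jost_residual q p A B z 0 Hq Hz0 Hz Hp).
  split.
  - intros H0. rewrite H0 in HL. apply NNPP. intros Hno.
    destruct (jost_coeff_lower q A B z Hq Hz) as [m [Hm Hlow]].
    { intros n Hn. apply Hno. exists n. left. exact Hn. }
    { intros n Hn. apply Hno. exists n. right. exact Hn. }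
    assert (Hz1 : 0 < Cmod z) by (apply Cmod_gt_0, Hz0).
    assert (Hzi : 0 < Cmod (/ z)).
    { rewrite Cmod_inv by exact Hz0. apply Rinv_0_lt_compat, Hz1. }
    assert (Hzz : Cmod z * Cmod z < 1) by nra.
    apply (Rlt_irrefl 0). apply Rlt_le_trans with (m * Cmod (/ z) * (1 - q) * (1 - Cmod z * Cmod z)).
    { repeat apply Rmult_lt_0_compat; lra. }
    rewrite <- Cmod_0. apply Clim_Cmod_ge with (2 := HL).
    intros N. rewrite Cmod_opp. simpl Cpow. rewrite pow1, !Cmod_mult, Cmod_1, Rmult_1_l, Rmult_1_r.
    assert (HSN := pow_unit_le q (S N) Hq). assert (HN := pow_unit_le q N Hq).
    assert (H3 : 1 - q <= Cmod (1 - RtoC (q ^ S N))%C).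
    { rewrite <- RtoC_minus, Cmod_R, Rabs_pos_eq; simpl in *; nra. }
    assert (H4 : 1 - Cmod z * Cmod z <= Cmod (1 - z * z * RtoC (q ^ S N))%C).
    { apply Rle_trans with (2 := Cmod_triangle_inv _ _).
      rewrite Cmod_1, !Cmod_mult, Cmod_R, Rabs_pos_eq by lra. nra. }
    repeat (apply Rmult_le_compat; repeat apply Rmult_le_pos; try apply Cmod_ge_0; try lra); auto.
  - intros [n0 Hn0].
    (* A zero factor at [n0] persists in all later products, so the residuals vanish for
       [N >= n0]. *)
    assert (Hd : forall n, jost_coeff q A B z (S (n + n0)) = 0%C).
    { intros n. unfold jost_coeff.
      assert (H : (cqpoch (A * z) q (S (n + n0)) * cqpoch (B * z) q (S (n + n0)))%C = 0%C).
      { induction n as [|n IH].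
        - simpl. destruct Hn0 as [-> | ->]; ring.
        - change (S n + n0)%nat with (S (n + n0)).
          transitivity ((cqpoch (A * z) q (S (n + n0)) * cqpoch (B * z) q (S (n + n0))) *
            ((1 - A * z * RtoC (q ^ S (n + n0))) * (1 - B * z * RtoC (q ^ S (n + n0)))))%C;
            [simpl; ring | rewrite IH; ring]. }
      rewrite H. unfold Cdiv. ring. }
    apply (is_lim_seq_incr_n _ n0) in HL.
    apply (Clim_unique (fun _ => 0%C)); [|apply Clim_const].
    apply is_lim_seq_ext with (2 := HL). intros n. cbv beta. rewrite Hd. do 2 f_equal. ring.
Qed.

Lemma jost_decay (q : R) (A B z : C) :
  0 < q < 1 -> Cmod z < 1 ->
  exists K, 0 < K /\ forall k, Cmod (jost q A B z k) <= K * Cmod z ^ k.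
Proof.
  intros Hq Hz. destruct (jost_coeff_bounded q A B z Hq Hz) as [D [HD0 HD]].
  exists (D / (1 - q)). split; [apply Rdiv_lt_0_compat; lra|].
  intros k. unfold jost. rewrite Cmod_mult, Cmod_pow, Rmult_comm.
  apply Rmult_le_compat_r; [apply pow_le, Cmod_ge_0|].
  apply Cmod_CSeries_le. apply jost_term_sum_bound; assumption.
Qed.

(** For large [k] the leading term 1 dominates, since the rest of the series is at most
    [D q^k / (1 - q) < 1]. This is what makes the decaying solution a genuine eigenvector when its
    defect vanishes. *)
Lemma jost_neq_0 (q : R) (A B z : C) :
  0 < q < 1 -> z <> 0%C -> Cmod z < 1 -> exists k, jost q A B z k <> 0%C.
Proof.
  intros Hq Hz0 Hz. destruct (jost_coeff_bounded q A B z Hq Hz) as [D [HD0 HD]].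
  destruct (pow_small q ((1 - q) / D)) as [k Hk]; [exact Hq | apply Rdiv_lt_0_compat; lra |].
  exists k. specialize (Hk k (le_n k)).
  apply Cmult_neq_0; [apply Cpow_nz, Hz0|].
  rewrite (CSeries_incr_1 _ _ (jost_term_sum_bound q D A B z k Hq HD0 HD)).
  assert (Hfirst : jost_term q A B z k 0 = RtoC 1).
  { unfold jost_term, jost_coeff. simpl. field. }
  rewrite Hfirst. intros H.
  assert (Hb : Cmod (CSeries (fun n => jost_term q A B z k (S n))) <= D * q ^ k / (1 - q)).
  { apply Cmod_CSeries_le. apply geometric_sum_bound; [lra | apply Rmult_le_pos; [lra | apply pow_le; lra] |].
    intros n. unfold jost_term.
    assert (H0 := pow_unit_le q k Hq). assert (Hn := pow_unit_le q n Hq).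
    assert (H1 : (q ^ S k) ^ S n <= q ^ k * q ^ n).
    { rewrite <- tech_pow_Rmult. apply Rmult_le_compat; [apply pow_le; lra | apply pow_le, pow_le; lra | simpl; nra |].
      apply pow_incr; simpl; nra. }
    assert (H2 : 0 <= (q ^ S k) ^ S n) by (apply pow_le, pow_le; lra).
    rewrite Cmod_mult, Cmod_R, Rabs_pos_eq by exact H2. rewrite Rmult_assoc.
    apply Rmult_le_compat; [apply Cmod_ge_0 | exact H2 | apply HD | exact H1]. }
  assert (Hone : Cmod (CSeries (fun n => jost_term q A B z k (S n))) = 1).
  { replace (CSeries (fun n => jost_term q A B z k (S n))) with (- (1))%C; [apply Cmod_m1|].
    transitivity (- (1) + (1 + CSeries (fun n => jost_term q A B z k (S n))))%C; [rewrite H; ring | ring]. }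
  rewrite Hone in Hb.
  assert (D * q ^ k / (1 - q) < 1); [|lra].
  apply Rmult_lt_reg_r with ((1 - q) / D); [apply Rdiv_lt_0_compat; lra|].
  replace (D * q ^ k / (1 - q) * ((1 - q) / D)) with (q ^ k) by (field; lra). lra.
Qed.

(** * Variation of parameters *)


(** The weight that makes [J] symmetric: [omega_S] is the detailed-balance relation between the
    off-diagonal coefficients [1 - p q^k] and [1 - q^(k+1)]. *)
Definition omega (q p : R) (k : nat) : R := qpoch p q k / qpoch q q k.

Lemma qpoch_pos (x q : R) (n : nat) : 0 < q < 1 -> x < 1 -> 0 < qpoch x q n.
Proof.
  intros Hq Hx. destruct (qpoch_bounds x q Hq Hx) as [m [M [Hm H]]]. specialize (H n). lra.
Qed.

Lemma omega_bounds (q p : R) :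
  0 < q < 1 -> p < 1 -> exists m M, 0 < m /\ forall k, m <= omega q p k <= M.
Proof.
  intros Hq Hp.
  destruct (qpoch_bounds p q Hq Hp) as [m [M [Hm H]]].
  destruct (qpoch_bounds q q Hq) as [m' [M' [Hm' H']]]; [lra|].
  exists (m * / M'), (M * / m').
  assert (HM' : 0 < M') by (specialize (H' 0%nat); lra).
  assert (Hi := Rinv_0_lt_compat _ HM').
  split; [apply Rmult_lt_0_compat; assumption|].
  intros k. specialize (H k). specialize (H' k). unfold omega, Rdiv.
  assert (Hk : 0 < / qpoch q q k) by (apply Rinv_0_lt_compat; lra).
  split; apply Rmult_le_compat; try lra; apply Rinv_le_contravar; lra.
Qed.

Lemma omega_S (q p : R) (k : nat) :
  0 < q < 1 -> omega q p (S k) * (1 - q ^ S k) = omega q p k * (1 - p * q ^ k).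
Proof.
  intros Hq. unfold omega. simpl.
  assert (H := qpoch_pos q q k Hq ltac:(lra)).
  assert (Hk := pow_unit_le q (S k) Hq). simpl in Hk.
  assert (q * q ^ k < 1) by (assert (H1 := pow_unit_le q k Hq); nra).
  field. lra.
Qed.

Lemma one_minus_pow_lower (q p : R) :
  0 < q < 1 -> p < 1 -> exists c, 0 < c /\ forall k, c <= 1 - p * q ^ k.
Proof.
  intros Hq Hp. exists (Rmin 1 (1 - p)). split; [apply Rmin_pos; lra|].
  intros k. assert (Hk := pow_unit_le q k Hq).
  destruct (Rle_lt_dec p 0) as [H | H].
  - apply Rle_trans with 1; [apply Rmin_l | nra].
  - apply Rle_trans with (1 - p); [apply Rmin_r | nra].
Qed.

Lemma RtoC_neq_0 (x : R) : 0 < x -> RtoC x <> 0%C.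
Proof. intros H E. apply RtoC_inj in E. lra. Qed.

(** The pair holds the values at [k] and [k + 1], as the recurrence has order two. For [p = A B],
    [sg = A + B] and [mu = 2 x] the first component is the Al-Salam-Chihara polynomial
    [Q_k(x; A, B | q)] divided by [(p;q)_k]. *)
Fixpoint regular_pair (q p : R) (sg mu : C) (k : nat) : C * C :=
  match k with
  | O => (RtoC 1, ((mu - sg) / RtoC (1 - p))%C)
  | S k' =>
      let w := regular_pair q p sg mu k' in
      (snd w, ((mu * snd w - sg * RtoC (q ^ k) * snd w - RtoC (1 - q ^ k) * fst w)
               / RtoC (1 - p * q ^ k))%C)
  end.

Definition regular (q p : R) (sg mu : C) (k : nat) : C := fst (regular_pair q p sg mu k).

Lemma regular_equation (q p : R) (sg mu : C) (k : nat) :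
  0 < q < 1 -> p < 1 ->
  Jop q p sg (regular q p sg mu) k = (mu * regular q p sg mu k)%C.
Proof.
  intros Hq Hp. destruct (one_minus_pow_lower q p Hq Hp) as [c [Hc Hck]].
  specialize (Hck k).
  assert (Hn : RtoC (1 - p * q ^ k) <> 0%C) by (apply RtoC_neq_0; lra).
  unfold Jop, regular. destruct k as [|k].
  - simpl. simpl in Hn. rewrite Rmult_1_r in *.
    replace (1 - 1) with 0 by ring. field. exact Hn.
  - change (pred (S k)) with k.
    change (fst (regular_pair q p sg mu (S (S k)))) with (snd (regular_pair q p sg mu (S k))).
    change (fst (regular_pair q p sg mu (S k))) with (snd (regular_pair q p sg mu k)).
    change (snd (regular_pair q p sg mu (S k))) with
      ((mu * snd (regular_pair q p sg mu k) - sg * RtoC (q ^ S k) * snd (regular_pair q p sg mu k)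
        - RtoC (1 - q ^ S k) * fst (regular_pair q p sg mu k)) / RtoC (1 - p * q ^ S k))%C.
    field. exact Hn.
Qed.

(* With [e k = z ^ k * phi k] the equation says that [e (k+2) - e (k+1)] is
   [z ^ 2 * (e (k+1) - e k)] up to an error [O (q ^ k)]; the weight [kap] below turns
   this into a Gronwall inequality. *)
Lemma regular_growth (q p : R) (sg z : C) :
  0 < q < 1 -> p < 1 -> z <> 0%C -> Cmod z < 1 ->
  exists K, 0 < K /\ forall k, Cmod z ^ k * Cmod (regular q p sg (z + / z)%C k) <= K.
Proof.
  intros Hq Hp Hz0 Hz.
  destruct (one_minus_pow_lower q p Hq Hp) as [c [Hc Hck]].
  set (phi := regular q p sg (z + / z)%C).
  set (e := fun k => (z ^ k * phi k)%C).
  assert (Hr0 : 0 < Cmod z) by (apply Cmod_gt_0, Hz0).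
  set (r := Cmod z) in *.
  assert (Hr2 : 0 < 1 - r ^ 2) by nra.
  (* Equality in [(1 + kap) r^2 <= kap] holds for [r^2 / (1 - r^2)]. The choice here is larger by 1,
     so that also [kap >= 1] and hence [|e k| <= X k] for the quantity [X] below. *)
  set (kap := / (1 - r ^ 2)).
  assert (Hkap1 : 1 <= kap).
  { unfold kap. rewrite <- Rinv_1 at 1. apply Rinv_le_contravar; nra. }
  assert (Hkap : (1 + kap) * r ^ 2 <= kap).
  { apply Rmult_le_reg_r with (1 - r ^ 2); [exact Hr2|]. unfold kap.
    replace ((1 + / (1 - r ^ 2)) * r ^ 2 * (1 - r ^ 2)) with ((2 - r ^ 2) * r ^ 2) by (field; lra).
    replace (/ (1 - r ^ 2) * (1 - r ^ 2)) with 1 by (field; lra).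
    assert (H := pow2_ge_0 (1 - r ^ 2)). nra. }
  set (C1 := (2 * Rabs p + Cmod sg + 1) * / c).
  assert (Hci : 0 < / c) by (apply Rinv_0_lt_compat, Hc).
  assert (Hp0 := Rabs_pos p). assert (Hsg0 := Cmod_ge_0 sg).
  assert (HC1 : 0 <= C1) by (apply Rmult_le_pos; lra).
  assert (Hdiff : forall k, Cmod (e (S (S k)) - e (S k))%C
      <= r ^ 2 * Cmod (e (S k) - e k)%C + q ^ k * C1 * (Cmod (e (S k)) + Cmod (e k))).
  { intros k. assert (Heq := regular_equation q p sg (z + / z)%C (S k) Hq Hp). fold phi in Heq.
    unfold Jop in Heq. simpl pred in Heq.
    specialize (Hck (S k)). assert (HQ := pow_unit_le q (S k) Hq). assert (Hqk := pow_unit_le q k Hq).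
    assert (HQk : q ^ S k <= q ^ k) by (simpl; nra).
    revert Heq Hck HQ HQk. generalize (q ^ S k). intros Q Heq Hck HQ HQk.
    assert (Hn : RtoC (1 - p * Q) <> 0%C) by (apply RtoC_neq_0; lra).
    assert (Hexp : (e (S (S k)) - e (S k))%C
      = (z * z * (e (S k) - e k)
         + RtoC Q * (/ RtoC (1 - p * Q) * (RtoC p * (z * z * (e (S k) - e k) + e (S k)) - sg * z * e (S k) + z * z * e k)))%C).
    { assert (H2 : phi (S (S k)) = (((z + / z) * phi (S k) - RtoC (1 - Q) * phi k - sg * RtoC Q * phi (S k)) / RtoC (1 - p * Q))%C).
      { rewrite <- Heq. field. exact Hn. }
      unfold e. rewrite H2, !Cpow_S. rewrite !RtoC_minus, !RtoC_mult in *. field. split; assumption. }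
    rewrite Hexp. apply Rle_trans with (1 := Cmod_triangle _ _).
    apply Rplus_le_compat.
    { rewrite !Cmod_mult. fold r. simpl. lra. }
    rewrite Cmod_mult, Cmod_R, Rabs_pos_eq by lra.
    rewrite Cmod_mult, Cmod_inv by exact Hn. rewrite Cmod_R, Rabs_pos_eq by lra.
    assert (Hin : / (1 - p * Q) <= / c) by (apply Rinv_le_contravar; lra).
    assert (Hip : 0 < / (1 - p * Q)) by (apply Rinv_0_lt_compat; lra).
    set (x := Cmod (e (S k))). set (y := Cmod (e k)).
    assert (Hx : 0 <= x) by apply Cmod_ge_0. assert (Hy : 0 <= y) by apply Cmod_ge_0.
    assert (Hbr : Cmod (RtoC p * (z * z * (e (S k) - e k) + e (S k)) - sg * z * e (S k) + z * z * e k)%C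
       <= (2 * Rabs p + Cmod sg + 1) * (x + y)).
    { apply Rle_trans with (1 := Cmod_triangle _ _).
      assert (Ha : Cmod (z * z * e k)%C <= y).
      { rewrite !Cmod_mult. fold r y. assert (r * r <= 1) by nra. nra. }
      assert (Hb := Cmod_minus_le (RtoC p * (z * z * (e (S k) - e k) + e (S k)))%C (sg * z * e (S k))%C).
      assert (Hc' : Cmod (sg * z * e (S k))%C <= Cmod sg * x).
      { rewrite !Cmod_mult. fold r x. assert (Cmod sg * r <= Cmod sg) by nra. nra. }
      assert (Hd : Cmod (RtoC p * (z * z * (e (S k) - e k) + e (S k)))%C <= Rabs p * (2 * (x + y))).
      { rewrite Cmod_mult, Cmod_R. apply Rmult_le_compat_l; [exact Hp0|].
        apply Rle_trans with (1 := Cmod_triangle _ _). rewrite !Cmod_mult. fold r x.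
        assert (Hm := Cmod_minus_le (e (S k)) (e k)). fold x y in Hm.
        assert (Hm0 := Cmod_ge_0 (e (S k) - e k)%C). assert (r * r <= 1) by nra. nra. }
      nra. }
    replace (q ^ k * C1 * (x + y)) with (q ^ k * (/ c * ((2 * Rabs p + Cmod sg + 1) * (x + y))))
      by (unfold C1; ring).
    apply Rmult_le_compat; [lra | apply Rmult_le_pos; [lra | apply Cmod_ge_0] | exact HQk |].
    apply Rmult_le_compat; [lra | apply Cmod_ge_0 | exact Hin | exact Hbr]. }
  set (X := fun k => Cmod (e (S k)) + kap * Cmod (e (S k) - e k)%C).
  assert (HX0 : forall k, 0 <= X k).
  { intros k. unfold X. assert (H1 := Cmod_ge_0 (e (S k))). assert (H2 := Cmod_ge_0 (e (S k) - e k)%C). nra. }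
  assert (HXS : forall k, X (S k) <= (1 + 2 * (1 + kap) * C1 * q ^ k) * X k).
  { intros k. unfold X. specialize (Hdiff k).
    assert (Ht := Cmod_triangle (e (S k)) (e (S (S k)) - e (S k))%C).
    replace (e (S k) + (e (S (S k)) - e (S k)))%C with (e (S (S k))) in Ht by ring.
    assert (Hs := Cmod_minus_le (e (S k)) (e (S k) - e k)%C).
    replace (e (S k) - (e (S k) - e k))%C with (e k) in Hs by ring.
    assert (H1 := Cmod_ge_0 (e (S k))). assert (H2 := Cmod_ge_0 (e (S k) - e k)%C).
    set (x := Cmod (e (S k))) in *. set (w := Cmod (e (S k) - e k)%C) in *.
    set (w2 := Cmod (e (S (S k)) - e (S k))%C) in *.
    assert (Hqk := pow_unit_le q k Hq).
    assert (HqC : 0 <= q ^ k * C1) by (apply Rmult_le_pos; lra).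
    assert (Hw2 : w2 <= r ^ 2 * w + (q ^ k * C1) * (2 * (x + kap * w))).
    { apply Rle_trans with (1 := Hdiff). apply Rplus_le_compat_l.
      apply Rmult_le_compat_l; [exact HqC|]. nra. }
    apply Rle_trans with (x + (1 + kap) * w2); [lra|].
    apply Rle_trans with (x + (1 + kap) * (r ^ 2 * w + (q ^ k * C1) * (2 * (x + kap * w)))).
    { apply Rplus_le_compat_l, Rmult_le_compat_l; [lra | exact Hw2]. }
    assert (Hkw : (1 + kap) * r ^ 2 * w <= kap * w) by (apply Rmult_le_compat_r; assumption).
    nra. }
  assert (HK0 : 0 <= 2 * (1 + kap) * C1) by (apply Rmult_le_pos; lra).
  assert (Hgr := gronwall_pow q _ X Hq HK0 HX0 HXS).
  set (K := X 0%nat * exp (2 * (1 + kap) * C1 / (1 - q))) in *.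
  assert (HKnn : 0 <= K) by (apply Rmult_le_pos; [apply HX0 | left; apply exp_pos]).
  exists (1 + K). split; [lra|]. intros k.
  destruct k as [|k].
  - unfold phi, regular. simpl. rewrite Cmod_1. lra.
  - replace (r ^ S k * Cmod (phi (S k))) with (Cmod (e (S k))) by (unfold e; rewrite Cmod_mult, Cmod_pow; reflexivity).
    specialize (Hgr k). unfold X in Hgr.
    assert (H2 := Cmod_ge_0 (e (S k) - e k)%C). nra.
Qed.

(** Discrete Abel identity: by [omega_S] the weighted Wronskian has the same value at all [k]. At
    [k = 0] only [u] is assumed to solve the equation, so evaluation there leaves the defect of [v]
    times [u 0]. *)
Lemma wronskian (q p : R) (sg mu : C) (u v : nat -> C) (k : nat) :
  0 < q < 1 ->
  (forall k, Jop q p sg u k = (mu * u k)%C) ->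
  (forall k, Jop q p sg v (S k) = (mu * v (S k))%C) ->
  (RtoC (omega q p k * (1 - p * q ^ k)) * (u (S k) * v k - u k * v (S k)))%C
  = (- (u 0%nat * (Jop q p sg v 0 - mu * v 0%nat)))%C.
Proof.
  intros Hq Hu Hv. induction k as [|k IH].
  - assert (H := Hu 0%nat). unfold Jop in *. simpl in *.
    replace (omega q p 0) with 1 by (unfold omega; simpl; field).
    rewrite Rmult_1_l. replace (1 - 1) with 0 in * by ring.
    transitivity ((RtoC (1 - p * 1) * u 1%nat + 0 * u 0%nat + sg * 1 * u 0%nat) * v 0%nat
      - sg * u 0%nat * v 0%nat - RtoC (1 - p * 1) * u 0%nat * v 1%nat)%C; [ring|].
    rewrite H. ring.
  - rewrite <- IH.
    assert (H1 := Hu (S k)). assert (H2 := Hv k). unfold Jop in H1, H2. simpl pred in *.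
    rewrite !RtoC_mult.
    transitivity (RtoC (omega q p (S k)) *
      ((RtoC (1 - p * q ^ S k) * u (S (S k)) + RtoC (1 - q ^ S k) * u k + sg * RtoC (q ^ S k) * u (S k)) * v (S k)
       - (RtoC (1 - p * q ^ S k) * v (S (S k)) + RtoC (1 - q ^ S k) * v k + sg * RtoC (q ^ S k) * v (S k)) * u (S k)
       + RtoC (1 - q ^ S k) * (u (S k) * v k - u k * v (S k))))%C; [ring|].
    rewrite H1, H2.
    transitivity ((RtoC (omega q p (S k)) * RtoC (1 - q ^ S k)) * (u (S k) * v k - u k * v (S k)))%C; [ring|].
    rewrite <- !RtoC_mult, (omega_S q p k Hq). reflexivity.
Qed.

(** The coefficient of [u (pred 0)] is [1 - q ^ 0 = 0], so the recurrence is of first order at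
    [k = 0] and [u 0] determines the solution. *)
Lemma Jop_solution_unique (q p : R) (sg mu : C) (u : nat -> C) :
  0 < q < 1 -> p < 1 -> (forall k, Jop q p sg u k = (mu * u k)%C) -> u 0%nat = 0%C ->
  forall k, u k = 0%C.
Proof.
  intros Hq Hp Hu H0.
  destruct (one_minus_pow_lower q p Hq Hp) as [c [Hc Hck]].
  assert (Hstep : forall k, u k = 0%C -> RtoC (1 - q ^ k) = 0%C \/ u (pred k) = 0%C -> u (S k) = 0%C).
  { intros k Hk Hk'. specialize (Hu k). unfold Jop in Hu. rewrite Hk in Hu.
    specialize (Hck k). assert (Hn : RtoC (1 - p * q ^ k) <> 0%C) by (apply RtoC_neq_0; lra).
    replace (u (S k)) with (/ RtoC (1 - p * q ^ k) * (RtoC (1 - p * q ^ k) * u (S k)))%C by (field; exact Hn).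
    replace (RtoC (1 - p * q ^ k) * u (S k))%C
      with (mu * 0 - RtoC (1 - q ^ k) * u (pred k) - sg * RtoC (q ^ k) * 0)%C by (rewrite <- Hu; ring).
    destruct Hk' as [-> | ->]; ring. }
  assert (Hboth : forall k, u k = 0%C /\ u (S k) = 0%C).
  { induction k as [|k [IH1 IH2]].
    - split; [exact H0|]. apply Hstep; [exact H0 | left; f_equal; simpl; ring].
    - split; [exact IH2|]. apply Hstep; [exact IH2 | right; exact IH1]. }
  intros k. apply Hboth.
Qed.

(** The Wronskian of [u] and [v] tends to 0, because [u] does and [v] is bounded. Being constant it
    is 0, so the product of [u 0] with the nonzero defect of [v] vanishes. *)
Lemma Jop_injective (q p : R) (sg mu : C) (u v : nat -> C) (B K : R) :
  0 < q < 1 -> p < 1 ->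
  l2le u B -> (forall k, Jop q p sg u k = (mu * u k)%C) ->
  (forall k, Cmod (v k) <= K) -> (forall k, Jop q p sg v (S k) = (mu * v (S k))%C) ->
  (Jop q p sg v 0 - mu * v 0%nat)%C <> 0%C ->
  forall k, u k = 0%C.
Proof.
  intros Hq Hp Hl2 Hu HK Hv Hd.
  apply (Jop_solution_unique q p sg mu u Hq Hp Hu).
  destruct (omega_bounds q p Hq Hp) as [m [M [Hm HM]]].
  assert (HM0 : 0 < M) by (specialize (HM 0%nat); lra).
  assert (HK0 : 0 <= K) by (apply Rle_trans with (2 := HK 0%nat); apply Cmod_ge_0).
  assert (Hlim : is_lim_seq (fun k => (M * (1 + Rabs p) * K) * (Cmod (u (S k)) + Cmod (u k))) 0).
  { apply lim_seq_scal_0, lim_seq_plus_0.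
    - apply (is_lim_seq_incr_1 (fun k => Cmod (u k))). apply l2le_lim_0 with B, Hl2.
    - apply l2le_lim_0 with B, Hl2. }
  assert (Hw : Clim (fun _ => - (u 0%nat * (Jop q p sg v 0 - mu * v 0%nat)))%C 0%C).
  { apply Clim_0. apply lim_seq_squeeze_0 with (2 := Hlim). intros k.
    split; [apply Cmod_ge_0|].
    rewrite <- (wronskian q p sg mu u v k Hq Hu Hv).
    rewrite Cmod_mult, Cmod_R, Rabs_mult, (Rabs_pos_eq (omega q p k)) by (specialize (HM k); lra).
    assert (Hqk := pow_unit_le q k Hq).
    assert (Hpq : Rabs (1 - p * q ^ k) <= 1 + Rabs p).
    { apply Rle_trans with (1 := Rabs_triang _ _).
      rewrite Rabs_R1, Rabs_Ropp, Rabs_mult, (Rabs_pos_eq (q ^ k)) by lra.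
      assert (H := Rabs_pos p). nra. }
    rewrite !Rmult_assoc. rewrite <- Rmult_assoc, <- (Rmult_assoc M).
    apply Rmult_le_compat.
    - apply Rmult_le_pos; [specialize (HM k); lra | apply Rabs_pos].
    - apply Cmod_ge_0.
    - apply Rmult_le_compat; [specialize (HM k); lra | apply Rabs_pos | apply HM | exact Hpq].
    - apply Rle_trans with (1 := Cmod_minus_le _ _). rewrite !Cmod_mult.
      assert (H1 := HK k). assert (H2 := HK (S k)).
      assert (H3 := Cmod_ge_0 (u k)). assert (H4 := Cmod_ge_0 (u (S k))). nra. }
  assert (H0 := Clim_unique _ _ _ Hw (Clim_const _)).
  apply NNPP. intros Hu0. apply (Cmult_neq_0 _ _ Hu0 Hd).
  transitivity (- - (u 0%nat * (Jop q p sg v 0 - mu * v 0%nat)))%C; [ring | rewrite <- H0; ring].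
Qed.

(** * Green's function on the half-line *)

Fixpoint green_head (q p : R) (phi h : nat -> C) (k : nat) : C :=
  match k with
  | O => 0%C
  | S k => (green_head q p phi h k + phi k * RtoC (omega q p k) * h k)%C
  end.

Definition green_tail (q p : R) (psi h : nat -> C) (k : nat) : C :=
  CSeries (fun i => psi (k + i)%nat * RtoC (omega q p (k + i)) * h (k + i)%nat)%C.

(** Kernel [psi(max(k,i)) omega(i) phi(min(k,i))]. The head runs over [i < k] and the tail over
    [i >= k], so the diagonal belongs to the tail. Division by the Wronskian is left to the
    resolvent. *)
Definition green (q p : R) (phi psi h : nat -> C) (k : nat) : C :=
  (psi k * green_head q p phi h k + phi k * green_tail q p psi h k)%C.

Lemma green_tail_sum_bound (q p : R) (psi h : nat -> C) (r K M B : R) :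
  0 <= r < 1 -> 0 <= K -> (forall k, 0 <= omega q p k <= M) ->
  (forall k, Cmod (psi k) <= K * r ^ k) -> l2le h B ->
  forall k n, sum_f_R0 (fun i => Cmod (psi (k + i)%nat * RtoC (omega q p (k + i)) * h (k + i)%nat)%C) n
    <= K * M * sqrt B * r ^ k / (1 - r).
Proof.
  intros Hr HK0 HM HK Hh k.
  assert (HM0 : 0 <= M) by (specialize (HM 0%nat); lra).
  assert (Hsq := sqrt_pos B).
  apply geometric_sum_bound; [exact Hr | repeat apply Rmult_le_pos; try assumption; apply pow_le; lra |].
  intros i. rewrite !Cmod_mult, Cmod_R, Rabs_pos_eq by apply HM.
  assert (Hhb : Cmod (h (k + i)%nat) <= sqrt B).
  { rewrite <- (sqrt_pow2 (Cmod (h (k + i)%nat))) by apply Cmod_ge_0.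
    apply sqrt_le_1_alt, l2le_point, Hh. }
  replace (K * M * sqrt B * r ^ k * r ^ i) with (K * r ^ (k + i) * M * sqrt B) by (rewrite pow_add; ring).
  apply Rmult_le_compat; [| apply Cmod_ge_0 | | exact Hhb].
  - apply Rmult_le_pos; [apply Cmod_ge_0 | apply HM].
  - apply Rmult_le_compat; [apply Cmod_ge_0 | apply HM | apply HK | apply HM].
Qed.

Lemma green_tail_S (q p : R) (psi h : nat -> C) (r K M B : R) (k : nat) :
  0 <= r < 1 -> 0 <= K -> (forall k, 0 <= omega q p k <= M) ->
  (forall k, Cmod (psi k) <= K * r ^ k) -> l2le h B ->
  green_tail q p psi h k = (psi k * RtoC (omega q p k) * h k + green_tail q p psi h (S k))%C.
Proof.
  intros Hr HK0 HM HK Hh. unfold green_tail at 1.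
  rewrite (CSeries_incr_1 _ _ (green_tail_sum_bound q p psi h r K M B Hr HK0 HM HK Hh k)).
  rewrite Nat.add_0_r. f_equal. unfold green_tail. f_equal.
  apply functional_extensionality. intros i. rewrite Nat.add_succ_r. reflexivity.
Qed.

(** Off the diagonal the kernel solves the homogeneous equation; on the diagonal the jump is the
    Wronskian, that is, the defect of [psi] at 0. This defect does no harm in the homogeneous part,
    where it meets the empty [green_head] at 0. *)
Lemma green_solves (q p : R) (sg mu : C) (phi psi h : nat -> C) :
  0 < q < 1 ->
  (forall k, Jop q p sg phi k = (mu * phi k)%C) -> phi 0%nat = RtoC 1 ->
  (forall k, Jop q p sg psi (S k) = (mu * psi (S k))%C) ->
  (forall k, green_tail q p psi h k
             = (psi k * RtoC (omega q p k) * h k + green_tail q p psi h (S k))%C) ->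
  forall k, (Jop q p sg (green q p phi psi h) k - mu * green q p phi psi h k)%C
            = ((Jop q p sg psi 0 - mu * psi 0%nat) * h k)%C.
Proof.
  intros Hq Hphi Hphi0 Hpsi Htail k.
  assert (HW := wronskian q p sg mu phi psi k Hq Hphi Hpsi). rewrite Hphi0 in HW.
  set (d := (Jop q p sg psi 0 - mu * psi 0%nat)%C) in *.
  assert (HW' : d = (- (RtoC (omega q p k * (1 - p * q ^ k)) * (phi (S k) * psi k - phi k * psi (S k))))%C)
    by (rewrite HW; ring).
  assert (Hcoef : forall k, (Jop q p sg psi k - mu * psi k)%C = 0%C \/ green_head q p phi h k = 0%C).
  { intros [|j]; [right; reflexivity | left; rewrite Hpsi; ring]. }
  (* Moving the split point from [k - 1] to [k] changes the two halves by opposite amounts, so the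
     value at [k - 1] may be written with the sums taken at [k]. *)
  assert (Hlow : (RtoC (1 - q ^ k) * green q p phi psi h (pred k))%C
     = (RtoC (1 - q ^ k) * (psi (pred k) * green_head q p phi h k + phi (pred k) * green_tail q p psi h k))%C).
  { destruct k as [|k].
    - replace (RtoC (1 - q ^ 0)) with (RtoC 0) by (f_equal; simpl; ring). ring.
    - simpl pred. f_equal. unfold green. simpl green_head. rewrite (Htail k). ring. }
  transitivity ((Jop q p sg psi k - mu * psi k) * green_head q p phi h k
    + (Jop q p sg phi k - mu * phi k) * green_tail q p psi h k + d * h k)%C.
  - rewrite HW'. unfold Jop. rewrite Hlow. unfold green. simpl green_head.
    replace (green_tail q p psi h (S k))
      with (green_tail q p psi h k - psi k * RtoC (omega q p k) * h k)%C by (rewrite (Htail k) at 1; ring).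
    rewrite RtoC_mult. ring.
  - rewrite Hphi. destruct (Hcoef k) as [-> | ->]; ring.
Qed.

(** Multiplied by [r^k] and divided by [r^k] respectively, head and tail satisfy first-order
    recurrences with ratio [r] and source a multiple of [|h|]. The tail identity is delivered as
    well, since it depends on the same convergence. *)
Lemma green_bounded (q p r Kphi Kpsi : R) (phi psi : nat -> C) :
  0 < q < 1 -> p < 1 -> 0 < r < 1 -> 0 < Kphi -> 0 < Kpsi ->
  (forall k, r ^ k * Cmod (phi k) <= Kphi) -> (forall k, Cmod (psi k) <= Kpsi * r ^ k) ->
  exists K, 0 <= K /\ forall h B, l2le h B -> 
    l2le (green q p phi psi h) (K * B) /\
    forall k, green_tail q p psi h k
             = (psi k * RtoC (omega q p k) * h k + green_tail q p psi h (S k))%C.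
Proof.
  intros Hq Hp Hr HK1 HK2 Hphi Hpsi.
  destruct (omega_bounds q p Hq Hp) as [m [M [Hm HM']]].
  assert (HM : forall k, 0 <= omega q p k <= M) by (intros k; specialize (HM' k); lra).
  assert (HM0 : 0 < M) by (specialize (HM' 0%nat); lra).
  assert (Hi : 0 < / (1 - r)) by (apply Rinv_0_lt_compat; lra).
  set (K1 := Kpsi ^ 2 * ((Kphi * M) ^ 2 / (1 - r) ^ 2)).
  (* The square of [Kpsi * M / (1 - r)] is the a priori bound [T] of [geometric_tail_l2] for
     [B = 1]; it comes from [|h i| <= sqrt B] and a geometric sum. *)
  set (K2 := Kphi ^ 2 * (((Kpsi * M / (1 - r)) ^ 2 + (Kpsi * M) ^ 2 / (1 - r)) / (1 - r))).
  assert (HK1' : 0 <= K1).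
  { apply Rmult_le_pos; [apply pow2_ge_0|]. apply Rmult_le_pos; [apply pow2_ge_0|].
    left. apply Rinv_0_lt_compat. nra. }
  assert (HK2' : 0 <= K2).
  { apply Rmult_le_pos; [apply pow2_ge_0|]. apply Rmult_le_pos; [|lra].
    apply Rplus_le_le_0_compat; [apply pow2_ge_0|]. apply Rmult_le_pos; [apply pow2_ge_0 | lra]. }
  exists (2 * K1 + 2 * K2). split; [lra|].
  intros h B Hh. assert (HB := l2le_nonneg h B Hh).
  assert (Htail : forall k, green_tail q p psi h k
             = (psi k * RtoC (omega q p k) * h k + green_tail q p psi h (S k))%C).
  { intros k. apply green_tail_S with r Kpsi M B; try assumption; lra. }
  split; [|exact Htail].
  assert (Hscal : forall c, 0 <= c -> forall n, sum_f_R0 (fun k => (c * Cmod (h k)) ^ 2) n <= c ^ 2 * B).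
  { intros c Hc n. rewrite (sum_eq _ (fun k => c ^ 2 * Cmod (h k) ^ 2)) by (intros; ring).
    rewrite sum_f_R0_mult. apply Rmult_le_compat_l; [apply pow2_ge_0 | apply Hh]. }
  replace ((2 * K1 + 2 * K2) * B) with (2 * (K1 * B) + 2 * (K2 * B)) by ring.
  unfold green. apply l2le_plus.
  - set (al := fun k => RtoC (r ^ k * Cmod (green_head q p phi h k))).
    assert (Hal : forall k, Cmod (al k) = r ^ k * Cmod (green_head q p phi h k)).
    { intros k. unfold al. rewrite Cmod_R, Rabs_pos_eq; [reflexivity|].
      apply Rmult_le_pos; [apply pow_le; lra | apply Cmod_ge_0]. }
    replace (K1 * B) with (Kpsi ^ 2 * ((Kphi * M) ^ 2 * B / (1 - r) ^ 2)) by (unfold K1; field; lra).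
    apply l2le_dominated with al; [lra | |].
    + intros k. rewrite Hal, Cmod_mult, <- Rmult_assoc.
      apply Rmult_le_compat_r; [apply Cmod_ge_0 | apply Hpsi].
    + intros n.
      apply (geometric_convolution_l2 r _ (fun k => Cmod (al k)) (fun k => Kphi * M * Cmod (h k))).
      * lra.
      * rewrite Hal. simpl. rewrite Cmod_0. ring.
      * intros; apply Cmod_ge_0.
      * intros k. rewrite !Hal. simpl green_head. rewrite <- tech_pow_Rmult.
        assert (Ht := Cmod_triangle (green_head q p phi h k) (phi k * RtoC (omega q p k) * h k)%C).
        rewrite !Cmod_mult, Cmod_R, Rabs_pos_eq in Ht by apply HM.
        specialize (Hphi k). specialize (HM k).
        assert (Hrk : 0 < r ^ k) by (apply pow_lt; lra).
        assert (Hhk := Cmod_ge_0 (h k)). assert (Hpk := Cmod_ge_0 (phi k)).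
        assert (Hph : r ^ k * Cmod (phi k) * (omega q p k * Cmod (h k)) <= Kphi * (M * Cmod (h k))).
        { apply Rmult_le_compat; [nra | nra | exact Hphi |]. apply Rmult_le_compat_r; lra. }
        assert (Hnn : 0 <= r ^ k * Cmod (phi k) * (omega q p k * Cmod (h k))).
        { apply Rmult_le_pos; apply Rmult_le_pos; lra. }
        apply Rle_trans with (r * r ^ k * (Cmod (green_head q p phi h k) + Cmod (phi k) * omega q p k * Cmod (h k))).
        { apply Rmult_le_compat_l; [apply Rmult_le_pos; lra | exact Ht]. }
        apply Rle_trans with (r * (r ^ k * Cmod (green_head q p phi h k)) + r * (r ^ k * Cmod (phi k) * (omega q p k * Cmod (h k)))); [lra|].
        apply Rplus_le_compat_l. nra.
      * apply Hscal. apply Rmult_le_pos; lra.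
  - set (ta := fun k => RtoC (Cmod (green_tail q p psi h k) / r ^ k)).
    assert (Hrk : forall k, 0 < r ^ k) by (intros; apply pow_lt; lra).
    assert (Hta : forall k, Cmod (ta k) = Cmod (green_tail q p psi h k) / r ^ k).
    { intros k. unfold ta. rewrite Cmod_R, Rabs_pos_eq; [reflexivity|].
      apply Rmult_le_pos; [apply Cmod_ge_0 | left; apply Rinv_0_lt_compat, Hrk]. }
    replace (K2 * B) with (Kphi ^ 2 * (((Kpsi * M / (1 - r)) ^ 2 * B + (Kpsi * M) ^ 2 * B / (1 - r)) / (1 - r)))
      by (unfold K2; field; lra).
    apply l2le_dominated with ta; [lra | |].
    + intros k. rewrite Hta, Cmod_mult.
      replace (Cmod (phi k) * Cmod (green_tail q p psi h k))
        with (r ^ k * Cmod (phi k) * (Cmod (green_tail q p psi h k) / r ^ k))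
        by (field; specialize (Hrk k); lra).
      apply Rmult_le_compat_r; [|apply Hphi].
      apply Rmult_le_pos; [apply Cmod_ge_0 | left; apply Rinv_0_lt_compat, Hrk].
    + intros n.
      apply (geometric_tail_l2 r _ _ (fun k => Cmod (ta k)) (fun k => Kpsi * M * Cmod (h k))).
      * lra.
      * intros; apply Cmod_ge_0.
      * intros k. rewrite !Hta, Htail.
        apply Rmult_le_reg_r with (r ^ k); [apply Hrk|].
        replace (Cmod (psi k * RtoC (omega q p k) * h k + green_tail q p psi h (S k))%C / r ^ k * r ^ k)
          with (Cmod (psi k * RtoC (omega q p k) * h k + green_tail q p psi h (S k))%C)
          by (field; specialize (Hrk k); lra).
        replace ((r * (Cmod (green_tail q p psi h (S k)) / r ^ S k) + Kpsi * M * Cmod (h k)) * r ^ k)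
          with (Kpsi * r ^ k * M * Cmod (h k) + Cmod (green_tail q p psi h (S k)))
          by (simpl; field; specialize (Hrk k); lra).
        apply Rle_trans with (1 := Cmod_triangle _ _). apply Rplus_le_compat_r.
        rewrite !Cmod_mult, Cmod_R, Rabs_pos_eq by apply HM.
        apply Rmult_le_compat_r; [apply Cmod_ge_0|].
        apply Rmult_le_compat; [apply Cmod_ge_0 | apply HM | apply Hpsi | apply HM].
      * intros k. rewrite Hta.
        replace ((Kpsi * M / (1 - r)) ^ 2 * B) with ((Kpsi * M / (1 - r) * sqrt B) ^ 2)
          by (rewrite Rpow_mult_distr, (pow2_sqrt B HB); reflexivity).
        apply pow_incr. split.
        { apply Rmult_le_pos; [apply Cmod_ge_0 | left; apply Rinv_0_lt_compat, Hrk]. }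
        apply Rmult_le_reg_r with (r ^ k); [apply Hrk|].
        replace (Cmod (green_tail q p psi h k) / r ^ k * r ^ k) with (Cmod (green_tail q p psi h k))
          by (field; specialize (Hrk k); lra).
        replace (Kpsi * M / (1 - r) * sqrt B * r ^ k) with (Kpsi * M * sqrt B * r ^ k / (1 - r)) by (field; lra).
        apply Cmod_CSeries_le. apply green_tail_sum_bound; try assumption; lra.
      * apply Hscal. apply Rmult_le_pos; lra.
Qed.

(** * Rescaling the weighted space *)


Lemma cscal_Cmult (r : R) (z : C) : cscal r z = (RtoC r * z)%C.
Proof. destruct z as [x y]. unfold cscal, Cmult, RtoC. simpl. f_equal; ring. Qed.

Lemma cnorm2_Cmod (z : C) : cnorm2 z = Cmod z ^ 2.
Proof. unfold cnorm2, Cmod. rewrite pow2_sqrt; [reflexivity|]. nra. Qed.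

Definition rescale (s : R) (f : nat -> C) (k : nat) : C := (RtoC (s ^ k) * f k)%C.

Lemma rescale_inv (s : R) (f : nat -> C) : s <> 0 -> rescale (/ s) (rescale s f) = f.
Proof.
  intros Hs. apply functional_extensionality. intros k. unfold rescale.
  rewrite Cmult_assoc, <- RtoC_mult, <- Rpow_mult_distr, Rinv_l, pow1 by exact Hs. ring.
Qed.

Lemma rescale_inv_r (s : R) (f : nat -> C) : s <> 0 -> rescale s (rescale (/ s) f) = f.
Proof.
  intros Hs. apply functional_extensionality. intros k. unfold rescale.
  rewrite Cmult_assoc, <- RtoC_mult, <- Rpow_mult_distr, Rinv_r, pow1 by exact Hs. ring.
Qed.

Lemma rescale_injective (s : R) (f g : nat -> C) :
  s <> 0 -> (forall k, rescale s f k = rescale s g k) -> f = g.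
Proof.
  intros Hs H. rewrite <- (rescale_inv s f Hs), <- (rescale_inv s g Hs).
  f_equal. apply functional_extensionality, H.
Qed.

(** Equivalence of norms is enough for boundedness and for the spectrum; the exact weight
    [omega q p k * (s ^ k) ^ 2] enters only in self-adjointness. *)
Definition weight_comparable (w : nat -> R) (s m M : R) : Prop :=
  0 < m /\ forall k, m * (s ^ k) ^ 2 <= w k <= M * (s ^ k) ^ 2.

Lemma Cmod_rescale_sqr (s : R) (f : nat -> C) (k : nat) :
  Cmod (rescale s f k) ^ 2 = (s ^ k) ^ 2 * Cmod (f k) ^ 2.
Proof. unfold rescale. rewrite Cmod_mult, Cmod_R, Rpow_mult_distr, pow2_abs. reflexivity. Qed.

Lemma sqnorm_l2le (w : nat -> R) (s m M : R) (f : nat -> C) (S : R) :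
  weight_comparable w s m M -> sqnorm w f S -> l2le (rescale s f) (S / m).
Proof.
  intros [Hm Hw] HS n.
  assert (Hle : sum_f_R0 (fun k => w k * cnorm2 (f k)) n <= S).
  { apply sum_incr; [exact HS|]. intros k. rewrite cnorm2_Cmod.
    apply Rmult_le_pos; [|apply pow2_ge_0]. apply Rle_trans with (2 := proj1 (Hw k)).
    apply Rmult_le_pos; [lra | apply pow2_ge_0]. }
  apply Rmult_le_reg_l with m; [exact Hm|].
  replace (m * (S / m)) with S by (field; lra).
  apply Rle_trans with (2 := Hle). rewrite <- sum_f_R0_mult. apply sum_Rle. intros k _.
  rewrite Cmod_rescale_sqr, cnorm2_Cmod, <- Rmult_assoc.
  apply Rmult_le_compat_r; [apply pow2_ge_0 | apply Hw].
Qed.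

Lemma l2le_sqnorm (w : nat -> R) (s m M : R) (f : nat -> C) (B : R) :
  weight_comparable w s m M -> l2le (rescale s f) B ->
  exists S, sqnorm w f S /\ S <= M * B.
Proof.
  intros [Hm Hw] HB.
  destruct (ex_series_bounded (fun k => w k * cnorm2 (f k)) (M * B)) as [Hex Hle].
  - intros k. rewrite cnorm2_Cmod. apply Rmult_le_pos; [|apply pow2_ge_0].
    apply Rle_trans with (2 := proj1 (Hw k)). apply Rmult_le_pos; [lra | apply pow2_ge_0].
  - intros n. apply Rle_trans with (sum_f_R0 (fun k => M * Cmod (rescale s f k) ^ 2) n).
    + apply sum_Rle. intros k _. rewrite Cmod_rescale_sqr, cnorm2_Cmod, <- Rmult_assoc.
      apply Rmult_le_compat_r; [apply pow2_ge_0 | apply Hw].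
    + rewrite sum_f_R0_mult. apply Rmult_le_compat_l; [|apply HB].
      specialize (Hw 0%nat). simpl in Hw. lra.
  - eexists. split; [|exact Hle]. apply is_series_Reals, Series_correct, Hex.
Qed.

Lemma sqnorm_unique (w : nat -> R) (f : nat -> C) (S S' : R) :
  sqnorm w f S -> sqnorm w f S' -> S = S'.
Proof. apply UL_sequence. Qed.

Lemma bounded_op_of_l2le (w : nat -> R) (s m M K : R) (F : seqC -> seqC) :
  weight_comparable w s m M -> 0 <= K ->
  (forall f B, l2le (rescale s f) B -> l2le (rescale s (F f)) (K * B)) ->
  bounded_op w F.
Proof.
  intros Hw HK HF. split.
  - intros f [S HS].
    destruct (l2le_sqnorm w s m M (F f) _ Hw (HF f _ (sqnorm_l2le w s m M f S Hw HS))) as [S' [HS' _]].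
    exists S'. exact HS'.
  - assert (HM : 0 <= M). { destruct Hw as [Hm Hw]. specialize (Hw 0%nat). simpl in Hw. lra. }
    assert (Hm : 0 < m) by apply Hw.
    exists (M * (K * / m)). split.
    { repeat apply Rmult_le_pos; try assumption. left. apply Rinv_0_lt_compat, Hm. }
    intros f S S' HS HS'.
    destruct (l2le_sqnorm w s m M (F f) _ Hw (HF f _ (sqnorm_l2le w s m M f S Hw HS))) as [S'' [HS'' Hle]].
    rewrite (sqnorm_unique w (F f) S' S'' HS' HS''). unfold Rdiv in Hle. lra.
Qed.

Lemma Jop_bounded (q p : R) (sg : C) :
  0 < q < 1 -> exists K, 0 <= K /\ forall g B, l2le g B -> l2le (Jop q p sg g) (K * B).
Proof.
  intros Hq. assert (Hp := Rabs_pos p). assert (Hs := Cmod_ge_0 sg).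
  exists (2 * (2 * (1 + Rabs p) ^ 2 + 2 * (1 ^ 2 * 2)) + 2 * Cmod sg ^ 2). split.
  { assert (H1 := pow2_ge_0 (1 + Rabs p)). assert (H2 := pow2_ge_0 (Cmod sg)). lra. }
  intros g B Hg. unfold Jop.
  replace ((2 * (2 * (1 + Rabs p) ^ 2 + 2 * (1 ^ 2 * 2)) + 2 * Cmod sg ^ 2) * B)
    with (2 * (2 * ((1 + Rabs p) ^ 2 * B) + 2 * (1 ^ 2 * (2 * B))) + 2 * (Cmod sg ^ 2 * B)) by ring.
  assert (Hqk : forall k, 0 < q ^ k <= 1) by (intros; apply pow_unit_le, Hq).
  apply l2le_plus; [apply l2le_plus|].
  - apply l2le_dominated with (fun k => g (S k)); [lra | | apply l2le_shift, Hg].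
    intros k. rewrite Cmod_mult, Cmod_R. apply Rmult_le_compat_r; [apply Cmod_ge_0|].
    apply Rle_trans with (1 := Rabs_triang _ _).
    rewrite Rabs_R1, Rabs_Ropp, Rabs_mult, (Rabs_pos_eq (q ^ k)) by (specialize (Hqk k); lra).
    specialize (Hqk k). nra.
  - apply l2le_dominated with (fun k => g (pred k)); [lra | | apply l2le_pred, Hg].
    intros k. rewrite Cmod_mult, Cmod_R. apply Rmult_le_compat_r; [apply Cmod_ge_0|].
    specialize (Hqk k). rewrite Rabs_pos_eq; lra.
  - apply l2le_dominated with g; [lra | | exact Hg].
    intros k. rewrite !Cmod_mult, Cmod_R, Rabs_pos_eq by (specialize (Hqk k); lra).
    apply Rmult_le_compat_r; [apply Cmod_ge_0|]. specialize (Hqk k). nra.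
Qed.

Definition conjugate_to_Jop (q p s : R) (sg : C) (T : seqC -> seqC) : Prop :=
  forall f k, rescale s (T f) k = ((1 + RtoC s * RtoC s) * rescale s f k - RtoC s * Jop q p sg (rescale s f) k)%C.

Lemma conjugate_bounded (q p s m M : R) (sg : C) (w : nat -> R) (T : seqC -> seqC) :
  0 < q < 1 -> weight_comparable w s m M -> conjugate_to_Jop q p s sg T -> bounded_op w T.
Proof.
  intros Hq Hw HT.
  destruct (Jop_bounded q p sg Hq) as [K [HK HJ]].
  set (c1 := Cmod (1 + RtoC s * RtoC s)%C). set (c2 := Cmod (- RtoC s)%C).
  apply bounded_op_of_l2le with s m M (2 * c1 ^ 2 + 2 * (c2 ^ 2 * K)); [exact Hw | |].
  { assert (H1 := pow2_ge_0 c1). assert (H2 := pow2_ge_0 c2). nra. }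
  intros f B Hf.
  apply l2le_ext with (fun k => (1 + RtoC s * RtoC s) * rescale s f k + (- RtoC s) * Jop q p sg (rescale s f) k)%C.
  { intros k. rewrite HT. ring. }
  replace ((2 * c1 ^ 2 + 2 * (c2 ^ 2 * K)) * B) with (2 * (c1 ^ 2 * B) + 2 * (c2 ^ 2 * (K * B))) by ring.
  apply l2le_plus.
  - apply l2le_dominated with (rescale s f); [apply Cmod_ge_0 | | exact Hf].
    intros k. rewrite Cmod_mult. right. reflexivity.
  - apply l2le_dominated with (Jop q p sg (rescale s f)); [apply Cmod_ge_0 | | apply HJ, Hf].
    intros k. rewrite Cmod_mult. right. reflexivity.
Qed.

(** Discrete Green formula. Detailed balance makes the off-diagonal terms telescope, the diagonal
    cancels because [sg] is real, and the left end contributes nothing as [1 - q ^ 0 = 0]. *)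
Lemma Jop_symmetric_partial_sums (q p : R) (sg : C) (F G : nat -> C) (N : nat) :
  0 < q < 1 -> Cconj sg = sg ->
  (Csum_n (fun k => RtoC (omega q p k) * (Jop q p sg F k * Cconj (G k) - F k * Cconj (Jop q p sg G k))) N)%C
  = (RtoC (omega q p N * (1 - p * q ^ N)) * (F (S N) * Cconj (G N) - F N * Cconj (G (S N))))%C.
Proof.
  intros Hq Hsg.
  assert (HR : forall r, Cconj (RtoC r) = RtoC r).
  { intros r. unfold Cconj, RtoC. simpl. rewrite Ropp_0. reflexivity. }
  induction N as [|N IH].
  - rewrite Csum_n_0. unfold Jop. rewrite !Cplus_conj, !Cmult_conj, !HR, Hsg, !pow_O.
    replace (1 - 1) with 0 by ring. rewrite RtoC_mult. ring.
  - rewrite Csum_n_S, IH, <- (omega_S q p N Hq). unfold Jop. simpl pred.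
    rewrite !Cplus_conj, !Cmult_conj, !HR, Hsg, !RtoC_mult. ring.
Qed.

(** The real constant [1 + s^2] cancels, so the partial sums of the two inner products differ by [s]
    times the boundary term of Green's formula. It tends to 0, since [F] tends to 0 and [G] is
    bounded. *)
Lemma conjugate_self_adjoint (q p s : R) (sg : C) (w : nat -> R) (T : seqC -> seqC) :
  0 < q < 1 -> p < 1 -> Cconj sg = sg -> 
  (forall k, w k = omega q p k * (s ^ k) ^ 2) -> conjugate_to_Jop q p s sg T ->
  (forall f, inL2 w f -> inL2 w (T f)) -> self_adjoint w T.
Proof.
  intros Hq Hp Hsg Hw HT Hdom f g Hf Hg.
  destruct (omega_bounds q p Hq Hp) as [m [M [Hm HM]]].
  assert (HM0 : 0 < M) by (specialize (HM 0%nat); lra).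
  assert (Hcomp : weight_comparable w s m M).
  { split; [exact Hm|]. intros k. rewrite Hw. specialize (HM k).
    split; apply Rmult_le_compat_r; try apply pow2_ge_0; lra. }
  destruct (Hdom f Hf) as [S1 HS1]. destruct Hf as [S2 HS2]. destruct Hg as [S3 HS3].
  assert (L1 := sqnorm_l2le w s m M (T f) S1 Hcomp HS1).
  assert (L2 := sqnorm_l2le w s m M f S2 Hcomp HS2).
  assert (L3 := sqnorm_l2le w s m M g S3 Hcomp HS3).
  set (F := rescale s f) in *. set (G := rescale s g) in *.
  assert (HR : forall r, Cconj (RtoC r) = RtoC r).
  { intros r. unfold Cconj, RtoC. simpl. rewrite Ropp_0. reflexivity. }
  assert (Hterm : forall (x y : nat -> C) k,
    cscal (w k) (cmul (x k) (cconj (y k))) = (RtoC (omega q p k) * (rescale s x k * Cconj (rescale s y k)))%C).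
  { intros x y k. rewrite cscal_Cmult, Hw. change (cmul (x k) (cconj (y k))) with (x k * Cconj (y k))%C.
    unfold rescale. rewrite Cmult_conj, HR. simpl pow. rewrite !RtoC_mult.
    change (@eq C (RtoC (omega q p k) * (RtoC (s ^ k) * (RtoC (s ^ k) * RtoC 1)) * (x k * Cconj (y k)))%C
      (RtoC (omega q p k) * (RtoC (s ^ k) * x k * (RtoC (s ^ k) * Cconj (y k))))%C). ring. }
  set (u := fun k => (RtoC (omega q p k) * (rescale s (T f) k * Cconj (G k)))%C).
  set (v := fun k => (RtoC (omega q p k) * (F k * Cconj (rescale s (T g) k)))%C).
  assert (Hu : Clim (Csum_n u) (CSeries u)).
  { apply CSeries_correct with (M * (S1 / m + S3 / m)). intros n.
    apply Rle_trans with (sum_f_R0 (fun k => M * (Cmod (rescale s (T f) k) ^ 2 + Cmod (G k) ^ 2)) n).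
    - apply sum_Rle. intros k _. unfold u.
      rewrite !Cmod_mult, Cmod_conj, Cmod_R, Rabs_pos_eq by (specialize (HM k); lra).
      assert (H1 := Cmod_ge_0 (rescale s (T f) k)). assert (H2 := Cmod_ge_0 (G k)).
      apply Rmult_le_compat; [specialize (HM k); lra | apply Rmult_le_pos; assumption | apply HM |].
      assert (H3 := pow2_ge_0 (Cmod (rescale s (T f) k) - Cmod (G k))). nra.
    - rewrite sum_f_R0_mult, plus_sum. apply Rmult_le_compat_l; [lra|].
      apply Rplus_le_compat; [apply L1 | apply L3]. }
  exists (CSeries u).
  assert (Hdiff : forall n, Csum_n v n = (Csum_n u n - - RtoC s * (RtoC (omega q p n * (1 - p * q ^ n)) * (F (S n) * Cconj (G n) - F n * Cconj (G (S n)))))%C).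
  { intros n. rewrite <- (Jop_symmetric_partial_sums q p sg F G n Hq Hsg).
    assert (Hk : forall k, v k = (u k - - RtoC s * (RtoC (omega q p k) * (Jop q p sg F k * Cconj (G k) - F k * Cconj (Jop q p sg G k))))%C).
    { intros k. unfold u, v. rewrite !HT. fold F G.
      rewrite Cminus_conj, !Cmult_conj, Cplus_conj, Cmult_conj, !HR. ring. }
    induction n as [|n IH].
    - rewrite !Csum_n_0. apply Hk.
    - rewrite !Csum_n_S, IH, Hk. ring. }
  assert (Hv : Clim (Csum_n v) (CSeries u)).
  { replace (CSeries u) with (CSeries u - - RtoC s * 0)%C by ring.
    apply Clim_ext with (1 := fun n => eq_sym (Hdiff n)).
    apply Clim_minus; [exact Hu|]. apply Clim_scal. apply Clim_0.
    assert (HB3 := l2le_nonneg G _ L3).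
    assert (HGb : forall k, Cmod (G k) <= sqrt (S3 / m)).
    { intros k. rewrite <- (sqrt_pow2 (Cmod (G k))) by apply Cmod_ge_0.
      apply sqrt_le_1_alt, l2le_point, L3. }
    assert (Hlim : is_lim_seq (fun n => (M * (1 + Rabs p) * sqrt (S3 / m)) * (Cmod (F (S n)) + Cmod (F n))) 0).
    { apply lim_seq_scal_0, lim_seq_plus_0.
      - apply (is_lim_seq_incr_1 (fun n => Cmod (F n))). apply l2le_lim_0 with (1 := L2).
      - apply l2le_lim_0 with (1 := L2). }
    apply lim_seq_squeeze_0 with (2 := Hlim). intros k. split; [apply Cmod_ge_0|].
    rewrite Cmod_mult, Cmod_R, Rabs_mult, (Rabs_pos_eq (omega q p k)) by (specialize (HM k); lra).
    assert (Hqk := pow_unit_le q k Hq).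
    assert (Hpq : Rabs (1 - p * q ^ k) <= 1 + Rabs p).
    { apply Rle_trans with (1 := Rabs_triang _ _).
      rewrite Rabs_R1, Rabs_Ropp, Rabs_mult, (Rabs_pos_eq (q ^ k)) by lra.
      assert (H := Rabs_pos p). nra. }
    rewrite (Rmult_assoc (M * (1 + Rabs p))).
    apply Rmult_le_compat.
    - apply Rmult_le_pos; [specialize (HM k); lra | apply Rabs_pos].
    - apply Cmod_ge_0.
    - apply Rmult_le_compat; [specialize (HM k); lra | apply Rabs_pos | apply HM | exact Hpq].
    - apply Rle_trans with (1 := Cmod_minus_le _ _). rewrite !Cmod_mult, !Cmod_conj.
      assert (H1 := HGb k). assert (H2 := HGb (S k)).
      assert (H3 := Cmod_ge_0 (F k)). assert (H4 := Cmod_ge_0 (F (S k))). nra. }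
  apply Clim_csum in Hu. apply Clim_csum in Hv.
  split.
  - unfold inner. replace (fun k => cscal (w k) (cmul (T f k) (cconj (g k)))) with u; [exact Hu|].
    apply functional_extensionality. intros k. rewrite Hterm. reflexivity.
  - unfold inner. replace (fun k => cscal (w k) (cmul (f k) (cconj (T g k)))) with v; [exact Hv|].
    apply functional_extensionality. intros k. rewrite Hterm. reflexivity.
Qed.

(** * The spectrum of the rescaled operator *)


(** The local [Tl] of [in_spectrum] under a name, convertible with it so that [change] can fold
    it. *)
Definition shift_op (T : seqC -> seqC) (lam : cplx) (f : seqC) : seqC :=
  fun k => csub (T f k) (cmul lam (f k)).

Lemma rescale_shift_op (q p s : R) (sg mu : C) (T : seqC -> seqC) (lam : C) (f : seqC) (k : nat) :
  conjugate_to_Jop q p s sg T -> lam = (1 + RtoC s * RtoC s - RtoC s * mu)%C ->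
  rescale s (shift_op T lam f) k
  = (- RtoC s * (Jop q p sg (rescale s f) k - mu * rescale s f k))%C.
Proof.
  intros HT Hlam.
  transitivity (rescale s (T f) k - lam * rescale s f k)%C.
  - unfold rescale, shift_op.
    change (csub (T f k) (cmul lam (f k))) with (T f k - lam * f k)%C. ring.
  - rewrite HT, Hlam. ring.
Qed.

Lemma weight_comparable_M_nonneg (w : nat -> R) (s m M : R) : weight_comparable w s m M -> 0 <= M.
Proof. intros [Hm Hw]. specialize (Hw 0%nat). simpl in Hw. lra. Qed.

Lemma resolvent_of_nonzero_boundary (q p s m M : R) (A B z : C) (w : nat -> R) (T : seqC -> seqC) (lam : C) :
  0 < q < 1 -> p < 1 -> 0 < s -> weight_comparable w s m M ->
  (A * B)%C = RtoC p -> conjugate_to_Jop q p s (A + B)%C T ->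
  z <> 0%C -> Cmod z < 1 -> lam = (1 + RtoC s * RtoC s - RtoC s * (z + / z))%C ->
  (forall n, (1 - A * z * RtoC (q ^ n))%C <> 0%C /\ (1 - B * z * RtoC (q ^ n))%C <> 0%C) ->
  ~ in_spectrum w T lam.
Proof.
  intros Hq Hp Hs Hw HAB HT Hz0 Hz Hlam Hnz Hspec. apply Hspec. clear Hspec.
  set (sg := (A + B)%C) in *. set (mu := (z + / z)%C) in *.
  set (phi := regular q p sg mu). set (psi := jost q A B z).
  assert (Hphi : forall k, Jop q p sg phi k = (mu * phi k)%C) by (intros; apply regular_equation; assumption).
  assert (Hpsi : forall k, Jop q p sg psi (S k) = (mu * psi (S k))%C) by (intros; apply jost_equation; assumption).
  set (d := (Jop q p sg psi 0 - mu * psi 0%nat)%C).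
  assert (Hd : d <> 0%C).
  { intros H. apply (proj1 (jost_boundary_zero q p A B z Hq Hz0 Hz HAB)) in H.
    destruct H as [n [H | H]]; destruct (Hnz n); contradiction. }
  assert (Hr0 : 0 < Cmod z) by (apply Cmod_gt_0, Hz0).
  destruct (regular_growth q p sg z Hq Hp Hz0 Hz) as [Kphi [HKphi Hgrow]]. fold mu phi in Hgrow.
  destruct (jost_decay q A B z Hq Hz) as [Kpsi [HKpsi Hdecay]]. fold psi in Hdecay.
  destruct (green_bounded q p (Cmod z) Kphi Kpsi phi psi Hq Hp (conj Hr0 Hz) HKphi HKpsi Hgrow Hdecay)
    as [K [HK Hgreen]].
  assert (HsC : RtoC s <> 0%C) by (apply RtoC_neq_0, Hs).
  (* Rescaling turns [T - lam] into [-s (J - mu)], and [J - mu] maps [green] to [d] times its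
     argument; [a] cancels both factors. *)
  set (a := (- / (RtoC s * d))%C).
  set (R0 := fun f : seqC => rescale (/ s) (fun k => a * green q p phi psi (rescale s f) k)%C).
  assert (HR0 : forall f, rescale s (R0 f) = fun k => (a * green q p phi psi (rescale s f) k)%C).
  { intros f. unfold R0. apply rescale_inv_r. lra. }
  assert (Hbd : forall f B0, l2le (rescale s f) B0 -> l2le (rescale s (R0 f)) (Cmod a ^ 2 * K * B0)).
  { intros f B0 Hf. rewrite HR0, Rmult_assoc.
    apply l2le_dominated with (green q p phi psi (rescale s f)); [apply Cmod_ge_0 | | apply Hgreen, Hf].
    intros k. rewrite Cmod_mult. right. reflexivity. }
  assert (Hright : forall f B0, l2le (rescale s f) B0 -> shift_op T lam (R0 f) = f).
  { intros f B0 Hf.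
    apply (rescale_injective s); [lra|]. intros k.
    rewrite (rescale_shift_op q p s sg mu T lam _ k HT Hlam), HR0.
    assert (Hsol := green_solves q p sg mu phi psi (rescale s f) Hq Hphi eq_refl Hpsi
              (proj2 (Hgreen _ _ Hf)) k).
    transitivity (- RtoC s * a * (Jop q p sg (green q p phi psi (rescale s f)) k
        - mu * green q p phi psi (rescale s f) k))%C; [unfold Jop; ring|].
    rewrite Hsol. fold d. unfold a. field. split; assumption. }
  assert (HK' : 0 <= Cmod a ^ 2 * K) by (apply Rmult_le_pos; [apply pow2_ge_0 | exact HK]).
  destruct (bounded_op_of_l2le w s m M _ R0 Hw HK' Hbd) as [Hdom Hnorm].
  assert (HT' := proj1 (conjugate_bounded q p s m M sg w T Hq Hw HT)).
  assert (Hl2 : forall f, inL2 w f -> exists B0, l2le (rescale s f) B0).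
  { intros f [S HS]. exists (S / m). apply sqnorm_l2le with w M; assumption. }
  exists R0. split; [exact Hdom|]. split; [exact Hnorm|]. split.
  - intros f Hf. destruct (Hl2 f Hf) as [Bf HBf].
    destruct (Hl2 _ (HT' f Hf)) as [BT HBT].
    change (R0 (shift_op T lam f) = f).
    (* Square summability of [(T - lam) f] is what allows the right-inverse property to be applied
       to it. *)
    assert (HL : l2le (rescale s (shift_op T lam f)) (2 * BT + 2 * (Cmod (- lam)%C ^ 2 * Bf))).
    { apply l2le_ext with (fun k => rescale s (T f) k + - lam * rescale s f k)%C.
      - intros k. rewrite (rescale_shift_op q p s sg mu T lam f k HT Hlam), HT, Hlam. ring.
      - apply l2le_plus; [exact HBT|].
        apply l2le_dominated with (rescale s f); [apply Cmod_ge_0 | | exact HBf].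
        intros k. rewrite Cmod_mult. right. reflexivity. }
    assert (Hrr := Hright _ _ HL).
    assert (HRB := Hbd _ _ HL).
    set (h := R0 (shift_op T lam f)) in *.
    (* By the right-inverse property [h] and [f] have the same image under [T - lam]; their
       difference is a square-summable homogeneous solution, hence zero. *)
    set (u := fun k => (rescale s h k + (- (1)) * rescale s f k)%C).
    assert (Hu0 : forall k, u k = 0%C).
    { apply (Jop_injective q p sg mu u psi
        (2 * (Cmod a ^ 2 * K * (2 * BT + 2 * (Cmod (- lam)%C ^ 2 * Bf))) + 2 * (1 ^ 2 * Bf)) Kpsi Hq Hp).
      - apply l2le_plus; [exact HRB|].
        apply l2le_dominated with (rescale s f); [lra | | exact HBf].
        intros k. rewrite Cmod_mult, Cmod_m1. right. reflexivity.
      - intros k.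
        assert (H1 := rescale_shift_op q p s sg mu T lam h k HT Hlam).
        assert (H2 := rescale_shift_op q p s sg mu T lam f k HT Hlam).
        rewrite Hrr, H2 in H1.
        assert (H3 : (Jop q p sg u k - mu * u k)%C
          = ((- / RtoC s) * (- RtoC s * (Jop q p sg (rescale s h) k - mu * rescale s h k)
                - - RtoC s * (Jop q p sg (rescale s f) k - mu * rescale s f k)))%C)
          by (unfold u, Jop; field; exact HsC).
        rewrite <- H1 in H3. apply Ceq_minus. rewrite H3. ring.
      - intros k. apply Rle_trans with (1 := Hdecay k).
        rewrite <- (Rmult_1_r Kpsi) at 2. apply Rmult_le_compat_l; [lra|].
        rewrite <- (pow1 k). apply pow_incr. lra.
      - exact Hpsi.
      - exact Hd. }
    apply (rescale_injective s); [lra|]. intros k. specialize (Hu0 k). unfold u in Hu0.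
    transitivity (rescale s h k + - (1) * rescale s f k + rescale s f k)%C; [ring | rewrite Hu0; ring].
  - intros f Hf. destruct (Hl2 f Hf) as [Bf HBf]. apply (Hright f Bf HBf).
Qed.

(** The candidate inverse is not assumed linear, so it is not known to fix 0. It is therefore
    evaluated on the common image 0 of the eigenvector and of the zero sequence, and would have to
    return both. *)
Lemma eigenvalue_of_zero_boundary (q p s m M : R) (A B z : C) (w : nat -> R) (T : seqC -> seqC) (lam : C) (n : nat) :
  0 < q < 1 -> p < 1 -> 0 < s -> weight_comparable w s m M ->
  (A * B)%C = RtoC p -> conjugate_to_Jop q p s (A + B)%C T ->
  z <> 0%C -> Cmod z < 1 -> lam = (1 + RtoC s * RtoC s - RtoC s * (z + / z))%C ->
  (1 - A * z * RtoC (q ^ n))%C = 0%C \/ (1 - B * z * RtoC (q ^ n))%C = 0%C ->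
  in_spectrum w T lam.
Proof.
  intros Hq Hp Hs Hw HAB HT Hz0 Hz Hlam Hzero [R0 [_ [_ [Hleft _]]]].
  change (forall f, inL2 w f -> R0 (shift_op T lam f) = f) in Hleft.
  set (psi := jost q A B z).
  assert (Hr0 : 0 < Cmod z) by (apply Cmod_gt_0, Hz0).
  assert (Heig : forall k, (Jop q p (A + B) psi k - (z + / z) * psi k)%C = 0%C).
  { intros [|k].
    - apply (jost_boundary_zero q p A B z Hq Hz0 Hz HAB). exists n. exact Hzero.
    - unfold psi. rewrite (jost_equation q p A B z k Hq Hz0 Hz HAB). ring. }
  assert (Hres : forall f, rescale s f = psi \/ rescale s f = (fun _ => RtoC 0) ->
     shift_op T lam f = fun _ => RtoC 0).
  { intros f Hf. apply (rescale_injective s); [lra|]. intros k.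
    rewrite (rescale_shift_op q p s (A + B)%C (z + / z)%C T lam f k HT Hlam).
    destruct Hf as [-> | ->].
    - rewrite Heig. unfold rescale. ring.
    - unfold Jop, rescale. ring. }
  assert (Hpsi : inL2 w (rescale (/ s) psi)).
  { destruct (jost_decay q A B z Hq Hz) as [K [HK Hdecay]].
    destruct (l2le_sqnorm w s m M (rescale (/ s) psi) (K ^ 2 / (1 - Cmod z ^ 2)) Hw) as [S [HS _]].
    - rewrite rescale_inv_r by lra. apply l2le_geometric; [lra | exact Hdecay].
    - exists S. exact HS. }
  assert (Hz' : inL2 w (fun _ => RtoC 0)).
  { destruct (l2le_sqnorm w s m M (fun _ => RtoC 0) 0 Hw) as [S [HS _]]; [|exists S; exact HS].
    intros j. rewrite (sum_eq _ (fun _ => 0 * 0)).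
    - rewrite sum_f_R0_mult. lra.
    - intros i _. unfold rescale. rewrite Cmult_0_r, Cmod_0. ring. }
  assert (H1 := Hleft _ Hpsi). assert (H2 := Hleft _ Hz').
  rewrite (Hres (rescale (/ s) psi)) in H1 by (left; apply rescale_inv_r; lra).
  rewrite (Hres (fun _ => RtoC 0)) in H2.
  2:{ right. apply functional_extensionality. intros k. unfold rescale. ring. }
  rewrite H2 in H1.
  destruct (jost_neq_0 q A B z Hq Hz0 Hz) as [k Hk]. apply Hk. fold psi.
  rewrite <- (rescale_inv_r s psi) by lra. rewrite <- H1. unfold rescale. ring.
Qed.

(** * Approximate eigenvectors on the unit circle *)

Lemma sum_indicator_lt (L n : nat) :
  sum_f_R0 (fun k => if (k <? L)%nat then 1 else 0) n = INR (Nat.min (S n) L).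
Proof.
  induction n as [|n IH].
  - simpl. destruct L as [|L]; simpl; [reflexivity | destruct L; reflexivity].
  - rewrite tech5, IH. destruct (Nat.ltb_spec (S n) L) as [H | H].
    + rewrite !Nat.min_l by lia. rewrite (S_INR (S n)). reflexivity.
    + rewrite !Nat.min_r by lia. ring.
Qed.

Lemma sum_indicator_eq_le (L n : nat) :
  sum_f_R0 (fun k => if (k =? L)%nat then 1 else 0) n <= 1.
Proof.
  assert (H : sum_f_R0 (fun k => if (k =? L)%nat then 1 else 0) n = if (L <=? n)%nat then 1 else 0).
  { induction n as [|n IH].
    - simpl. destruct L; reflexivity.
    - rewrite tech5, IH. destruct (Nat.eqb_spec (S n) L); destruct (Nat.leb_spec L n);
        destruct (Nat.leb_spec L (S n)); try lia; ring. }
  rewrite H. destruct (L <=? n)%nat; lra.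
Qed.

(* The truncated oscillation [z ^ k] on [k <= L] has squared norm of order [L], whereas the
   recurrence fails on it only at the two cut-off points and up to a summable error. *)
Lemma truncated_power_residual (q p : R) (sg z : C) (L : nat) :
  0 < q < 1 -> Cmod z = 1 ->
  let v := fun k => if (k <? S L)%nat then (z ^ k)%C else 0%C in
  let c := Rabs p + 1 + Cmod sg in
  l2le (fun k => Jop q p sg v k - (z + / z) * v k)%C (2 * (2 * (c ^ 2 / (1 - q ^ 2)) + 2 * c ^ 2) + 2 * c ^ 2).
Proof.
  intros Hq Hz v c.
  assert (Hz0 : z <> 0%C) by (intros ->; rewrite Cmod_0 in Hz; lra).
  assert (Hp := Rabs_pos p). assert (Hsg := Cmod_ge_0 sg).
  assert (Hzk : forall k, Cmod (z ^ k)%C = 1) by (intros; rewrite Cmod_pow, Hz; apply pow1).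
  assert (Hzi : Cmod (/ z)%C = 1) by (rewrite Cmod_inv, Hz by exact Hz0; field).
  (* [w1] is the error of [z ^ k] against constant coefficients, [w2] the missing right neighbour at
     [L], [w3] the surviving left neighbour at [L + 1]. The bound does not involve [L]. *)
  set (w1 := fun k => if (k <? S L)%nat then (RtoC (q ^ k) * z ^ k * (- RtoC p * z - / z + sg))%C else 0%C).
  set (w2 := fun k => if (k =? L)%nat then (- (RtoC (1 - p * q ^ k) * z ^ S k))%C else 0%C).
  set (w3 := fun k => if (k =? S L)%nat then (RtoC (1 - q ^ k) * z ^ L)%C else 0%C).
  apply l2le_ext with (fun k => w1 k + w2 k + w3 k)%C.
  { intros k. unfold Jop, v, w1, w2, w3.
    destruct (Nat.lt_trichotomy k L) as [H | [-> | H]].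
    - rewrite (proj2 (Nat.ltb_lt k (S L))), (proj2 (Nat.ltb_lt (S k) (S L))),
        (proj2 (Nat.ltb_lt (pred k) (S L))), (proj2 (Nat.eqb_neq k L)), (proj2 (Nat.eqb_neq k (S L))) by lia.
      rewrite Cpow_S. destruct k as [|k].
      + simpl pred. rewrite !pow_O. replace (1 - 1) with 0 by ring. simpl Cpow.
        rewrite !RtoC_minus, !RtoC_mult. field. exact Hz0.
      + simpl pred. rewrite !Cpow_S, !RtoC_minus, !RtoC_mult. field. exact Hz0.
    - rewrite (proj2 (Nat.ltb_lt L (S L))), (proj2 (Nat.ltb_ge (S L) (S L))),
        (proj2 (Nat.ltb_lt (pred L) (S L))), (proj2 (Nat.eqb_eq L L)), (proj2 (Nat.eqb_neq L (S L))) by lia.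
      rewrite Cpow_S. destruct L as [|k].
      + simpl pred. rewrite !pow_O. replace (1 - 1) with 0 by ring. simpl Cpow.
        rewrite !RtoC_minus, !RtoC_mult. field. exact Hz0.
      + simpl pred. rewrite !Cpow_S, !RtoC_minus, !RtoC_mult. field. exact Hz0.
    - rewrite (proj2 (Nat.ltb_ge k (S L))), (proj2 (Nat.ltb_ge (S k) (S L))), (proj2 (Nat.eqb_neq k L)) by lia.
      destruct (Nat.eqb_spec k (S L)) as [-> | Hne].
      + simpl pred. rewrite (proj2 (Nat.ltb_lt L (S L))) by lia. ring.
      + rewrite (proj2 (Nat.ltb_ge (pred k) (S L))) by lia. ring. }
  assert (Hpt : forall (L0 : nat) (u : nat -> C),
     (forall k, Cmod (u k) <= if (k =? L0)%nat then c else 0) -> l2le u (c ^ 2)).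
  { intros L0 u Hu n.
    apply Rle_trans with (sum_f_R0 (fun k => c ^ 2 * (if (k =? L0)%nat then 1 else 0)) n).
    - apply sum_Rle. intros k _. specialize (Hu k). assert (H0 := Cmod_ge_0 (u k)).
      destruct (k =? L0)%nat; [rewrite Rmult_1_r; apply pow_incr; lra | nra].
    - rewrite sum_f_R0_mult. assert (H := sum_indicator_eq_le L0 n). assert (H2 := pow2_ge_0 c). nra. }
  assert (Hqk : forall k, 0 < q ^ k <= 1) by (intros; apply pow_unit_le, Hq).
  apply l2le_plus; [apply l2le_plus|].
  - apply l2le_geometric; [lra|]. intros k. unfold w1.
    destruct (k <? S L)%nat.
    + rewrite !Cmod_mult, Hzk, Cmod_R, Rabs_pos_eq by (specialize (Hqk k); lra).
      rewrite Rmult_1_r, Rmult_comm. apply Rmult_le_compat_r; [specialize (Hqk k); lra|].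
      apply Rle_trans with (1 := Cmod_triangle _ _).
      assert (H := Cmod_minus_le (- RtoC p * z)%C (/ z)%C).
      rewrite Cmod_mult, Cmod_opp, Cmod_R, Hz, Hzi in H. unfold c. lra.
    + rewrite Cmod_0. apply Rmult_le_pos; [unfold c; lra | specialize (Hqk k); lra].
  - apply Hpt with L. intros k. unfold w2. destruct (k =? L)%nat; [|rewrite Cmod_0; lra].
    rewrite Cmod_opp, Cmod_mult, Hzk, Cmod_R, Rmult_1_r.
    apply Rle_trans with (1 := Rabs_triang _ _).
    rewrite Rabs_R1, Rabs_Ropp, Rabs_mult, (Rabs_pos_eq (q ^ k)) by (specialize (Hqk k); lra).
    specialize (Hqk k). unfold c. nra.
  - apply Hpt with (S L). intros k. unfold w3. destruct (k =? S L)%nat; [|rewrite Cmod_0; lra].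
    rewrite Cmod_mult, Hzk, Cmod_R, Rmult_1_r, Rabs_pos_eq by (specialize (Hqk k); lra).
    specialize (Hqk k). unfold c. lra.
Qed.

Lemma spectrum_of_unit_circle (q p s m M : R) (sg z : C) (w : nat -> R) (T : seqC -> seqC) (lam : C) :
  0 < q < 1 -> 0 < s -> weight_comparable w s m M -> conjugate_to_Jop q p s sg T ->
  Cmod z = 1 -> lam = (1 + RtoC s * RtoC s - RtoC s * (z + / z))%C ->
  in_spectrum w T lam.
Proof.
  intros Hq Hs Hw HT Hz Hlam [R0 [_ [[K [HK Hnorm]] [Hleft _]]]].
  change (forall f, inL2 w f -> R0 (shift_op T lam f) = f) in Hleft.
  assert (HM := weight_comparable_M_nonneg w s m M Hw).
  assert (Hm : 0 < m) by apply Hw.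
  set (c := Rabs p + 1 + Cmod sg).
  set (D := 2 * (2 * (c ^ 2 / (1 - q ^ 2)) + 2 * c ^ 2) + 2 * c ^ 2).
  (* A left inverse with constant [K] would force [L + 1 <= S1 / m <= K * (M * (s ^ 2 * D)) / m],
     which this [L] contradicts. *)
  destruct (INR_unbounded (K * (M * (s ^ 2 * D)) / m)) as [L HL].
  set (v := fun k => if (k <? S L)%nat then (z ^ k)%C else 0%C).
  assert (Hvk : forall k, Cmod (v k) ^ 2 = if (k <? S L)%nat then 1 else 0).
  { intros k. unfold v. destruct (k <? S L)%nat; [rewrite Cmod_pow, Hz, pow1 | rewrite Cmod_0]; ring. }
  assert (Hsum : forall n, sum_f_R0 (fun k => Cmod (v k) ^ 2) n = INR (Nat.min (S n) (S L))).
  { intros n. rewrite <- sum_indicator_lt. apply sum_eq. intros; apply Hvk. }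
  set (f := rescale (/ s) v).
  assert (Hf : rescale s f = v) by (apply rescale_inv_r; lra).
  destruct (l2le_sqnorm w s m M f (INR (S L)) Hw) as [S1 [HS1 _]].
  { rewrite Hf. intros n. rewrite Hsum. apply le_INR. lia. }
  assert (Hres := truncated_power_residual q p sg z L Hq Hz). cbv zeta in Hres. fold v c D in Hres.
  destruct (l2le_sqnorm w s m M (shift_op T lam f) (s ^ 2 * D) Hw) as [S2 [HS2 HS2le]].
  { apply l2le_dominated with (g := fun k => (Jop q p sg v k - (z + / z) * v k)%C);
      [lra | | exact Hres].
    intros k. rewrite (rescale_shift_op q p s sg (z + / z)%C T lam f k HT Hlam), Hf.
    rewrite Cmod_mult, Cmod_opp, Cmod_R, Rabs_pos_eq by lra. right. reflexivity. }
  assert (Hinv := Hleft f (ex_intro _ S1 HS1)).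
  assert (HS12 : S1 <= K * S2) by (apply (Hnorm (shift_op T lam f)); [exact HS2 | rewrite Hinv; exact HS1]).
  assert (Hlow := sqnorm_l2le w s m M f S1 Hw HS1 L). rewrite Hf, Hsum, Nat.min_id, S_INR in Hlow.
  assert (Hle : S1 <= K * (M * (s ^ 2 * D))).
  { apply Rle_trans with (1 := HS12). apply Rmult_le_compat_l; assumption. }
  assert (Hfin : S1 / m <= K * (M * (s ^ 2 * D)) / m).
  { apply Rmult_le_compat_r; [left; apply Rinv_0_lt_compat, Hm | exact Hle]. }
  lra.
Qed.

(** * The substitution [mu = z + 1/z] *)

Lemma Csqrt_exists (d : C) : exists u, (u * u)%C = d.
Proof.
  destruct d as [x y].
  set (t := Cmod (x, y)).
  assert (Ht0 : 0 <= t) by apply Cmod_ge_0.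
  assert (Ht2 : t * t = x * x + y * y).
  { unfold t, Cmod. simpl. rewrite sqrt_sqrt; nra. }
  assert (Hxt : - t <= x <= t) by (split; nra).
  (* Half-angle formulas: the square root has real part [sqrt ((t + x) / 2)] and imaginary part
     [sqrt ((t - x) / 2)] with the sign of [y]. *)
  assert (Ha : 0 <= (t + x) / 2) by lra. assert (Hb : 0 <= (t - x) / 2) by lra.
  assert (Hprod : sqrt ((t + x) / 2) * sqrt ((t - x) / 2) = Rabs y / 2).
  { rewrite <- sqrt_mult by assumption. rewrite <- (sqrt_square (Rabs y / 2)).
    - f_equal. assert (Hy := Rsqr_abs y). unfold Rsqr in Hy. nra.
    - assert (H := Rabs_pos y). lra. }
  assert (Hsa := sqrt_sqrt _ Ha). assert (Hsb := sqrt_sqrt _ Hb).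
  set (al := sqrt ((t + x) / 2)) in *. set (be := sqrt ((t - x) / 2)) in *.
  destruct (Rle_lt_dec 0 y) as [Hy | Hy].
  - exists (al, be). unfold Cmult. simpl. rewrite Rabs_pos_eq in Hprod by lra. f_equal; lra.
  - exists (al, - be). unfold Cmult. simpl. rewrite Rabs_left in Hprod by lra. f_equal; lra.
Qed.

(** The two roots of [z^2 - mu z + 1] have product 1, so they are inverse to each other and one of
    them lies in the closed unit disc. *)
Lemma joukowski_exists (mu : C) : exists z : C, z <> 0%C /\ Cmod z <= 1 /\ mu = (z + / z)%C.
Proof.
  destruct (Csqrt_exists (mu * mu / 4 - 1)%C) as [u Hu].
  assert (Hprod : ((mu / 2 + u) * (mu / 2 - u))%C = RtoC 1).
  { transitivity (mu * mu / 4 - u * u)%C; [|rewrite Hu; ring].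
    replace (RtoC 4) with (RtoC 2 * RtoC 2)%C by (rewrite <- RtoC_mult; f_equal; ring).
    field. }
  assert (Hn : (mu / 2 + u)%C <> 0%C).
  { intros H. rewrite H, Cmult_0_l in Hprod. apply C1_nz. symmetry. exact Hprod. }
  assert (Hn' : (mu / 2 - u)%C <> 0%C).
  { intros H. rewrite H, Cmult_0_r in Hprod. apply C1_nz. symmetry. exact Hprod. }
  assert (Huniq : forall x y : C, x <> 0%C -> (x * y)%C = RtoC 1 -> (/ x)%C = y).
  { intros x y Hx Hxy. transitivity (/ x * (x * y))%C; [rewrite Hxy; ring | field; exact Hx]. }
  assert (Hinv := Huniq _ _ Hn Hprod).
  assert (Hinv' := Huniq _ _ Hn' (eq_trans (Cmult_comm _ _) Hprod)).
  assert (Hmod := f_equal Cmod Hprod). rewrite Cmod_mult, Cmod_1 in Hmod.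
  destruct (Rle_lt_dec (Cmod (mu / 2 + u)%C) 1) as [H | H].
  - exists (mu / 2 + u)%C. split; [exact Hn|]. split; [exact H|]. rewrite Hinv. field.
  - exists (mu / 2 - u)%C. split; [exact Hn'|]. split.
    + assert (H0 := Cmod_ge_0 (mu / 2 - u)%C). nra.
    + rewrite Hinv'. field.
Qed.

(** On the unit circle [z + 1/z = 2 Re z], which runs through [[-2, 2]]; the end points of the
    interval are [z = 1] and [z = -1]. *)
Lemma unit_circle_segment (s : R) (lam : C) :
  0 < s ->
  (exists z, Cmod z = 1 /\ lam = (1 + RtoC s * RtoC s - RtoC s * (z + / z))%C) <->
  snd lam = 0 /\ (1 - s) ^ 2 <= fst lam <= (1 + s) ^ 2.
Proof.
  intros Hs. split.
  - intros [[x y] [Hz ->]].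
    assert (Hxy : x * x + y * y = 1).
    { unfold Cmod in Hz. simpl in Hz. apply (f_equal (fun r => r * r)) in Hz.
      rewrite sqrt_sqrt in Hz; nra. }
    assert (Hinv : (/ (x, y))%C = (x, - y)).
    { unfold Cinv. simpl. replace (x * (x * 1) + y * (y * 1)) with 1 by lra. f_equal; field. }
    rewrite Hinv. simpl. split; [ring|].
    assert (Hx : -1 <= x <= 1) by (split; nra). split; nra.
  - destruct lam as [l l']. simpl. intros [-> Hl].
    set (x := (1 + s * s - l) / (2 * s)).
    assert (Hx : 2 * s * x = 1 + s * s - l) by (unfold x; field; lra).
    assert (Hx1 : -1 <= x <= 1) by (split; nra).
    assert (Hy : 0 <= 1 - x * x) by nra.
    set (y := sqrt (1 - x * x)).
    assert (Hxy : y * y = 1 - x * x) by (apply sqrt_sqrt, Hy).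
    exists (x, y). split.
    + unfold Cmod. simpl. replace (x * (x * 1) + y * (y * 1)) with 1 by lra. apply sqrt_1.
    + assert (Hinv : (/ (x, y))%C = (x, - y)).
      { unfold Cinv. simpl. replace (x * (x * 1) + y * (y * 1)) with 1 by lra. f_equal; field. }
      rewrite Hinv. unfold Cminus, Cplus, Copp, Cmult, RtoC. simpl. f_equal; lra.
Qed.

(** * Cyclicity and the rescaling of the operator *)


Definition C_linear (T : seqC -> seqC) : Prop :=
  forall (x : C) (f g : nat -> C), T (fun k => x * f k + g k)%C = (fun k => x * T f k + T g k)%C.

Definition in_cyclic_span (T : seqC -> seqC) (v h : seqC) : Prop := exists cs, h = polyT T cs v.

Lemma C_linear_0 (T : seqC -> seqC) : C_linear T -> T (fun _ => RtoC 0) = fun _ => RtoC 0.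
Proof.
  intros HT. assert (H := HT (- (1))%C (fun _ => RtoC 0) (fun _ => RtoC 0)).
  cbv beta in H.
  replace (fun _ : nat => (- (1) * RtoC 0 + RtoC 0)%C) with (fun _ : nat => RtoC 0) in H
    by (apply functional_extensionality; intros; ring).
  apply functional_extensionality. intros k.
  transitivity (- (1) * T (fun _ => RtoC 0) k + T (fun _ => RtoC 0) k)%C.
  - exact (f_equal (fun g => g k) H).
  - change (@eq C (- (1) * T (fun _ => RtoC 0) k + T (fun _ => RtoC 0) k)%C (RtoC 0)). ring.
Qed.

Lemma polyT_T (T : seqC -> seqC) (cs : list cplx) (v : seqC) :
  C_linear T -> polyT T cs (T v) = T (polyT T cs v).
Proof.
  intros HT. revert v. induction cs as [|x cs IH]; intros v.
  - symmetry. apply (C_linear_0 T HT).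
  - simpl. rewrite IH. symmetry. apply (HT x v (polyT T cs (T v))).
Qed.

Lemma in_cyclic_span_lin (T : seqC -> seqC) (v f g : seqC) (x : C) :
  in_cyclic_span T v f -> in_cyclic_span T v g ->
  in_cyclic_span T v (fun k => x * f k + g k)%C.
Proof.
  (* [polyT] recurses by replacing [v] with [T v], so the induction has to range over all [v]. *)
  intros [cs1 ->] [cs2 ->]. revert v cs2.
  induction cs1 as [|a1 cs1 IH]; intros v cs2.
  - exists cs2. apply functional_extensionality. intros k. simpl.
    change (@eq C (x * RtoC 0 + polyT T cs2 v k)%C (polyT T cs2 v k)). ring.
  - destruct cs2 as [|a2 cs2].
    + destruct (IH (T v) nil) as [cs Hcs]. exists ((x * a1)%C :: cs).
      apply functional_extensionality. intros k. simpl. rewrite <- Hcs.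
      change (@eq C (x * (a1 * v k + polyT T cs1 (T v) k) + RtoC 0)%C
                (x * a1 * v k + (x * polyT T cs1 (T v) k + RtoC 0))%C). ring.
    + destruct (IH (T v) cs2) as [cs Hcs]. exists ((x * a1 + a2)%C :: cs).
      apply functional_extensionality. intros k. simpl. rewrite <- Hcs.
      change (@eq C (x * (a1 * v k + polyT T cs1 (T v) k) + (a2 * v k + polyT T cs2 (T v) k))%C
                ((x * a1 + a2) * v k + (x * polyT T cs1 (T v) k + polyT T cs2 (T v) k))%C). ring.
Qed.

Lemma in_cyclic_span_T (T : seqC -> seqC) (v f : seqC) :
  C_linear T -> in_cyclic_span T v f -> in_cyclic_span T v (T f).
Proof.
  intros HT [cs ->]. exists (RtoC 0 :: cs). rewrite <- (polyT_T T cs v HT).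
  apply functional_extensionality. intros k. simpl.
  assert (H : forall x y : C, y = (RtoC 0 * x + y)%C) by (intros; ring).
  apply (H (v k)).
Qed.

Definition basis_vec (N : nat) : seqC := fun k => if (k =? N)%nat then RtoC 1 else RtoC 0.

(** [T (basis_vec N)] ends at [N + 1] with a nonzero entry; subtracting a multiple of it removes the
    last entry of [h], and it lies in the span by the induction hypothesis. *)
Lemma finitely_supported_in_cyclic_span (T : seqC -> seqC) :
  C_linear T ->
  (forall N k, (S N < k)%nat -> T (basis_vec N) k = RtoC 0) ->
  (forall N, T (basis_vec N) (S N) <> RtoC 0) ->
  forall N h, (forall k, (N < k)%nat -> h k = RtoC 0) -> in_cyclic_span T (basis_vec 0) h.
Proof.
  intros HT Hband Hne N. induction N as [|N IH]; intros h Hh.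
  - exists (h 0%nat :: nil). apply functional_extensionality. intros k. simpl. unfold basis_vec.
    destruct k as [|k].
    + change (@eq C (h 0%nat) (h 0%nat * RtoC 1 + RtoC 0)%C). ring.
    + rewrite Hh by lia. change (@eq C (RtoC 0) (h 0%nat * RtoC 0 + RtoC 0)%C). ring.
  - set (x := (h (S N) / T (basis_vec N) (S N))%C).
    replace h with (fun k => x * T (basis_vec N) k + (- x * T (basis_vec N) k + h k))%C
      by (apply functional_extensionality; intros k;
          change (@eq C (x * T (basis_vec N) k + (- x * T (basis_vec N) k + h k))%C (h k)); ring).
    apply in_cyclic_span_lin.
    + apply in_cyclic_span_T; [exact HT|]. apply IH. intros k Hk. unfold basis_vec.
      rewrite (proj2 (Nat.eqb_neq k N)) by lia. reflexivity.
    + apply IH. intros k Hk. destruct (Nat.eq_dec k (S N)) as [-> | Hk'].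
      * change (@eq C (- x * T (basis_vec N) (S N) + h (S N))%C (RtoC 0)).
        unfold x. field. apply Hne.
      * rewrite Hband, Hh by lia.
        change (@eq C (- x * RtoC 0 + RtoC 0)%C (RtoC 0)). ring.
Qed.

Lemma sum_tail_indicator (u : nat -> R) (N n : nat) :
  sum_f_R0 (fun k => if (k <=? N)%nat then 0 else u k) n + sum_f_R0 u N = sum_f_R0 u (Nat.max n N).
Proof.
  induction n as [|n IH].
  - simpl. ring.
  - rewrite tech5. destruct (Nat.leb_spec (S n) N) as [H | H].
    + rewrite Nat.max_r in IH |- * by lia. lra.
    + rewrite Nat.max_l in IH |- * by lia. rewrite tech5. lra.
Qed.

Lemma simple_spectrum_of_band (w : nat -> R) (T : seqC -> seqC) :
  (forall k, 0 <= w k) -> C_linear T ->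
  (forall N k, (S N < k)%nat -> T (basis_vec N) k = RtoC 0) ->
  (forall N, T (basis_vec N) (S N) <> RtoC 0) ->
  simple_spectrum w T.
Proof.
  intros Hw HT Hband Hne.
  assert (Hterm : forall (f : nat -> C) k, 0 <= w k * cnorm2 (f k)).
  { intros f k. apply Rmult_le_pos; [apply Hw|]. rewrite cnorm2_Cmod. apply pow2_ge_0. }
  exists (basis_vec 0). split.
  - destruct (ex_series_bounded (fun k => w k * cnorm2 (basis_vec 0 k)) (w 0%nat)) as [Hex _].
    + intros k. apply (Hterm (basis_vec 0)).
    + intros n. induction n as [|n IH]; [unfold cnorm2; simpl; lra|].
      rewrite tech5. unfold cnorm2 at 2. simpl. lra.
    + eexists. apply is_series_Reals, Series_correct, Hex.
  - intros f [S HS] eps Heps.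
    destruct (HS eps Heps) as [N HN]. specialize (HN N (le_n N)).
    assert (Hle : forall n, sum_f_R0 (fun k => w k * cnorm2 (f k)) n <= S).
    { intros n. apply sum_incr; [exact HS | apply Hterm]. }
    (* The truncation of [f] lies in the span exactly, and its squared distance to [f] is at most
       the tail of the series for the norm of [f], which is below [eps]. *)
    set (h := fun k => if (k <=? N)%nat then f k else RtoC 0).
    destruct (finitely_supported_in_cyclic_span T HT Hband Hne N h) as [cs Hcs].
    { intros k Hk. unfold h. rewrite (proj2 (Nat.leb_gt k N)) by lia. reflexivity. }
    exists cs. rewrite <- Hcs.
    set (u := fun k => w k * cnorm2 (f k)) in *.
    destruct (ex_series_bounded (fun k => w k * cnorm2 (csub (f k) (h k))) (S - sum_f_R0 u N)) as [Hex Hs].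
    + intros k. apply (Hterm (fun k => csub (f k) (h k))).
    + intros n. rewrite (sum_eq _ (fun k => if (k <=? N)%nat then 0 else u k)).
      * assert (H := sum_tail_indicator u N n). specialize (Hle (Nat.max n N)). lra.
      * intros k _. unfold h, u. destruct (k <=? N)%nat; unfold cnorm2, csub, cadd, copp; simpl; ring.
    + eexists. split; [apply is_series_Reals, Series_correct, Hex|].
      apply Rle_lt_trans with (1 := Hs).
      unfold Rdist in HN. specialize (Hle N). rewrite Rabs_left1 in HN by lra. lra.
Qed.

(** * The operator [Tgamma]: linearity, cyclic vector, rescaled form *)

Lemma Tgamma_linear (a b q : R) (gamma : cplx) : C_linear (Tgamma a b q gamma).
Proof.
  intros x f g. apply functional_extensionality. intros k. unfold Tgamma. cbv zeta.
  rewrite !cscal_Cmult.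
  set (u := RtoC (a * q * (b * q * q ^ k - 1))). set (v := RtoC (q ^ k - 1)).
  set (y := (RtoC (q ^ k) * gamma)%C).
  change (@eq C
   (u * ((x * f (S k) + g (S k)) - (x * f k + g k)) + v * ((x * f (pred k) + g (pred k)) - (x * f k + g k))
     + y * (x * f k + g k))%C
   (x * (u * (f (S k) - f k) + v * (f (pred k) - f k) + y * f k)
     + (u * (g (S k) - g k) + v * (g (pred k) - g k) + y * g k))%C).
  ring.
Qed.

Lemma Tgamma_simple_spectrum (a b q : R) (gamma : cplx) (w : nat -> R) :
  0 < q < 1 -> (forall k, 0 <= w k) -> simple_spectrum w (Tgamma a b q gamma).
Proof.
  intros Hq Hw. apply simple_spectrum_of_band; [exact Hw | apply Tgamma_linear | |].
  - intros N k Hk. unfold Tgamma, basis_vec. cbv zeta.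
    rewrite (proj2 (Nat.eqb_neq (S k) N)), (proj2 (Nat.eqb_neq k N)), (proj2 (Nat.eqb_neq (pred k) N)) by lia.
    unfold cadd, cscal, csub, cmul, copp, cadd, RtoC. simpl. f_equal; ring.
  - intros N H. unfold Tgamma, basis_vec in H. cbv zeta in H.
    rewrite (proj2 (Nat.eqb_neq (S (S N)) N)), (proj2 (Nat.eqb_neq (S N) N)), (proj2 (Nat.eqb_eq (pred (S N)) N)) in H by lia.
    apply (f_equal fst) in H. unfold cadd, cscal, csub, cmul, copp, cadd, RtoC in H. cbn [fst snd] in H.
    assert (H1 := pow_unit_le q N Hq). simpl in H. nra.
Qed.

(** The diagonal entry at [x = q^k] is [1 + a q + x (gamma - 1 - a b q^2)]; this explains both the
    constant [1 + s^2] and the form required of [gamma]. *)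
Lemma Tgamma_conjugate (a b q s : R) (sg gamma : C) :
  0 < q < 1 -> s * s = a * q ->
  gamma = (1 + RtoC (a * b * q ^ 2) - RtoC s * sg)%C ->
  conjugate_to_Jop q (q * b) s sg (Tgamma a b q gamma).
Proof.
  intros Hq Hs Hg f k. unfold rescale at 1, Tgamma. cbv zeta. rewrite !cscal_Cmult.
  change (cadd (cadd (RtoC (a * q * (b * q * q ^ k - 1)) * csub (f (S k)) (f k))%C
                     (RtoC (q ^ k - 1) * csub (f (pred k)) (f k))%C)
               (cmul (RtoC (q ^ k) * gamma)%C (f k)))
    with (RtoC (a * q * (b * q * q ^ k - 1)) * (f (S k) - f k)
          + RtoC (q ^ k - 1) * (f (pred k) - f k) + RtoC (q ^ k) * gamma * f k)%C.
  assert (Hpred : (RtoC s * (RtoC (1 - q ^ k) * (RtoC (s ^ pred k) * f (pred k))))%C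
                  = (RtoC (1 - q ^ k) * (RtoC (s ^ k) * f (pred k)))%C).
  { destruct k as [|k].
    - replace (RtoC (1 - q ^ 0)) with (RtoC 0) by (f_equal; simpl; ring). ring.
    - simpl pred. rewrite <- (tech_pow_Rmult s k), RtoC_mult. ring. }
  unfold Jop, rescale.
  transitivity ((1 + RtoC s * RtoC s) * (RtoC (s ^ k) * f k)
    - RtoC s * (RtoC (1 - q * b * q ^ k) * (RtoC (s ^ S k) * f (S k))
                + sg * RtoC (q ^ k) * (RtoC (s ^ k) * f k))
    - RtoC s * (RtoC (1 - q ^ k) * (RtoC (s ^ pred k) * f (pred k))))%C; [|ring].
  rewrite Hpred, Hg, <- (tech_pow_Rmult s k).
  replace (a * q * (b * q * q ^ k - 1)) with (s * s * (b * q * q ^ k - 1)) by (rewrite Hs; ring).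
  replace (a * b * q ^ 2) with (s * s * (b * q)) by (rewrite <- (Rmult_assoc), Hs; ring).
  rewrite !RtoC_mult, !RtoC_minus, !RtoC_mult. ring.
Qed.

Lemma weight_omega (a b q s : R) (k : nat) :
  s * s = a * q -> weight a b q k = omega q (q * b) k * (s ^ k) ^ 2.
Proof.
  intros Hs. unfold weight, omega. rewrite <- Hs, <- pow_mult, Nat.mul_comm, pow_mult.
  simpl (s ^ 2). rewrite Rmult_1_r. reflexivity.
Qed.

(** * The spectrum in the original parameters *)


(** With [X = 1/z] the right side is the product form of the discrete families: there [X] is [A q^k]
    or [B q^l], the inverse of the point where a boundary factor vanishes. *)
Lemma spectral_point (s : R) (X z : C) :
  (X * z)%C = RtoC 1 ->
  (1 + RtoC s * RtoC s - RtoC s * (z + / z))%C = ((1 - RtoC s * z) * (1 - RtoC s * X))%C.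
Proof.
  intros H.
  assert (Hz : z <> 0%C) by (intros Hz; rewrite Hz, Cmult_0_r in H; apply C1_nz; symmetry; exact H).
  replace X with (/ z)%C; [field; exact Hz|].
  transitivity (/ z * (X * z))%C; [rewrite H; ring | field; exact Hz].
Qed.

Lemma Cinv_of_product_1 (X z : C) : X <> 0%C -> (X * z)%C = RtoC 1 -> z = (/ X)%C.
Proof. intros HX H. transitivity (/ X * (X * z))%C; [field; exact HX | rewrite H; ring]. Qed.

Lemma sqrt_params (q a : R) :
  0 < q < 1 -> 0 < a ->
  0 < sqrt (a * q) /\ 0 < sqrt (q / a) /\ sqrt (a * q) * sqrt (a * q) = a * q /\
  sqrt (a * q) * sqrt (q / a) = q /\ sqrt (a * q) = a * sqrt (q / a).
Proof.
  intros Hq Ha.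
  assert (Haq : 0 < a * q) by (apply Rmult_lt_0_compat; lra).
  assert (Hqa : 0 < q / a) by (apply Rdiv_lt_0_compat; lra).
  assert (Hs := sqrt_lt_R0 _ Haq). assert (Ht := sqrt_lt_R0 _ Hqa).
  assert (Hst : sqrt (a * q) * sqrt (q / a) = q).
  { rewrite <- sqrt_mult by lra. replace (a * q * (q / a)) with (q * q) by (field; lra).
    apply sqrt_square. lra. }
  assert (Htt : sqrt (q / a) * sqrt (q / a) = q / a) by (apply sqrt_sqrt; lra).
  repeat split; try assumption; [apply sqrt_sqrt; lra|].
  apply Rmult_eq_reg_r with (sqrt (q / a)); [|lra].
  rewrite Hst, Rmult_assoc, Htt. field. lra.
Qed.

Lemma Cmod_inv_lt_1 (X : C) : Cmod X > 1 -> X <> 0%C /\ (/ X)%C <> 0%C /\ Cmod (/ X) < 1.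
Proof.
  intros H.
  assert (HX : X <> 0%C) by (apply Cmod_gt_0; lra).
  assert (Hi : Cmod (/ X) = / Cmod X) by (apply Cmod_inv, HX).
  assert (Hp : 0 < / Cmod X) by (apply Rinv_0_lt_compat; lra).
  split; [exact HX|]. split; [apply Cmod_gt_0; lra|].
  rewrite Hi, <- Rinv_1. apply Rinv_lt_contravar; lra.
Qed.

Lemma Cmod_gt_1_of_product (X z : C) : Cmod z < 1 -> (X * z)%C = RtoC 1 -> Cmod X > 1.
Proof.
  intros Hz H. apply (f_equal Cmod) in H. rewrite Cmod_mult, Cmod_1 in H.
  assert (H0 := Cmod_ge_0 z). assert (H1 := Cmod_ge_0 X). nra.
Qed.

Section Spectrum.

Context (q a b : R) (c : C) (Hq : 0 < q < 1) (Ha : 0 < a) (Hb : b < / q) (Hc : c <> 0%C).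

Let s := sqrt (a * q).
Let t := sqrt (q / a).
Let A : C := (RtoC s * c)%C.
Let B : C := (RtoC (b * t) * / c)%C.

(** The scaling of [A] and [B] comes from here: [s A = a q c], and [s B = b q / c] because
    [s t = q]. *)
Lemma gammaC_sum : gammaC a b q c = (1 + RtoC (a * b * q ^ 2) - RtoC s * (A + B))%C :> C.
Proof.
  destruct (sqrt_params q a Hq Ha) as [Hs [Ht [Hss [Hst _]]]]. fold s t in Hs, Ht, Hss, Hst.
  unfold gammaC. rewrite !cscal_Cmult.
  transitivity (RtoC (1 + a * b * q ^ 2) - (RtoC (s * s) * c + RtoC (b * (s * t)) * / c))%C.
  - rewrite Hss, Hst. reflexivity.
  - unfold A, B. rewrite RtoC_plus, !RtoC_mult. ring.
Qed.

Lemma AB_product : (A * B)%C = RtoC (q * b).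
Proof.
  destruct (sqrt_params q a Hq Ha) as [Hs [Ht [Hss [Hst _]]]]. fold s t in Hs, Ht, Hss, Hst.
  rewrite <- Hst. unfold A, B. rewrite !RtoC_mult. field. exact Hc.
Qed.

Lemma first_family_point (k : nat) (z : C) :
  (A * z * RtoC (q ^ k))%C = RtoC 1 ->
  cmul (csub Defs.c1 (cscal (/ q ^ k) (cinv c))) (csub Defs.c1 (cscal (a * q ^ (S k)) c))
  = (1 + RtoC s * RtoC s - RtoC s * (z + / z))%C :> C.
Proof.
  intros Hz. destruct (sqrt_params q a Hq Ha) as [Hs [Ht [Hss [Hst _]]]]. fold s t in Hs, Ht, Hss, Hst.
  assert (Hqk : 0 < q ^ k) by (apply pow_lt; lra).
  assert (HsC := RtoC_neq_0 s Hs). assert (HqC := RtoC_neq_0 _ Hqk).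
  rewrite !cscal_Cmult.
  change (((1 - RtoC (/ q ^ k) * / c) * (1 - RtoC (a * q ^ S k) * c))%C
    = (1 + RtoC s * RtoC s - RtoC s * (z + / z))%C).
  rewrite (spectral_point s (A * RtoC (q ^ k)) z) by (rewrite <- Hz; ring).
  rewrite (Cinv_of_product_1 (A * RtoC (q ^ k)) z).
  - replace (a * q ^ S k) with (s * s * q ^ k) by (rewrite Hss; simpl; ring).
    rewrite RtoC_inv, !RtoC_mult by lra. unfold A. field. repeat split; assumption.
  - unfold A. repeat apply Cmult_neq_0; assumption.
  - rewrite <- Hz. ring.
Qed.

Lemma second_family_point (l : nat) (z : C) :
  (B * z * RtoC (q ^ l))%C = RtoC 1 ->
  cmul (csub Defs.c1 (cscal (b * q ^ (S l)) (cinv c))) (csub Defs.c1 (cscal (a / q ^ l / b) c))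
  = (1 + RtoC s * RtoC s - RtoC s * (z + / z))%C :> C.
Proof.
  intros Hz. destruct (sqrt_params q a Hq Ha) as [Hs [Ht [Hss [Hst Hat]]]]. fold s t in Hs, Ht, Hss, Hst, Hat.
  assert (Hql : 0 < q ^ l) by (apply pow_lt; lra).
  assert (HtC := RtoC_neq_0 t Ht). assert (HqC := RtoC_neq_0 _ Hql).
  (* The quotient by [b] is meaningful because [b = 0] would give [B = 0], against [B z q^l = 1].
     For [b = 0] the second family is empty. *)
  assert (Hb0 : b <> 0).
  { intros Hb0. apply C1_nz. rewrite <- Hz. unfold B. rewrite Hb0, Rmult_0_l. ring. }
  assert (HbC : RtoC b <> 0%C) by (intros E; apply RtoC_inj in E; contradiction).
  rewrite !cscal_Cmult.
  change (((1 - RtoC (b * q ^ S l) * / c) * (1 - RtoC (a / q ^ l / b) * c))%C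
    = (1 + RtoC s * RtoC s - RtoC s * (z + / z))%C).
  rewrite (spectral_point s (B * RtoC (q ^ l)) z) by (rewrite <- Hz; ring).
  rewrite (Cinv_of_product_1 (B * RtoC (q ^ l)) z).
  - replace (b * q ^ S l) with (s * t * b * q ^ l) by (rewrite Hst; simpl; ring).
    rewrite Hat. rewrite !RtoC_div, !RtoC_mult by lra. unfold B. rewrite RtoC_mult.
    field. repeat split; assumption.
  - unfold B. rewrite RtoC_mult. repeat apply Cmult_neq_0; try assumption.
    apply Cmod_gt_0. rewrite Cmod_inv by exact Hc. apply Rinv_0_lt_compat, Cmod_gt_0, Hc.
  - rewrite <- Hz. ring.
Qed.

(** A boundary factor vanishes exactly when [z] is the inverse of [A q^k] or [B q^l], and such a [z]
    lies in the open unit disc exactly when that number has modulus above 1: these are the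
    conditions in [spec_set]. *)
Lemma spectrum_eq (w : nat -> R) (T : seqC -> seqC) (m M : R) (lam : C) :
  weight_comparable w s m M -> conjugate_to_Jop q (q * b) s (A + B)%C T ->
  in_spectrum w T lam <-> spec_set a b q c lam.
Proof.
  intros Hw HT.
  destruct (sqrt_params q a Hq Ha) as [Hs [Ht [Hss [Hst Hat]]]]. fold s t in Hs, Ht, Hss, Hst, Hat.
  assert (Hp : q * b < 1).
  { replace 1 with (q * / q) by (field; lra). apply Rmult_lt_compat_l; lra. }
  assert (HAB := AB_product).
  assert (HXA : forall k, cscal (q ^ k * sqrt (a * q)) c = (A * RtoC (q ^ k))%C).
  { intros k. fold s. rewrite cscal_Cmult, RtoC_mult. unfold A.
    change (@eq C (RtoC (q ^ k) * RtoC s * c)%C (RtoC s * c * RtoC (q ^ k))%C). ring. }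
  assert (HXB : forall l, cscal (q ^ l * b * sqrt (q / a)) (cinv c) = (B * RtoC (q ^ l))%C).
  { intros l. fold t. rewrite cscal_Cmult. unfold B. rewrite !RtoC_mult.
    change (@eq C (RtoC (q ^ l) * RtoC b * RtoC t * / c)%C (RtoC b * RtoC t * / c * RtoC (q ^ l))%C). ring. }
  unfold spec_set. fold s. split.
  - intros Hspec.
    assert (HsC := RtoC_neq_0 s Hs).
    destruct (joukowski_exists ((1 + RtoC s * RtoC s - lam) / RtoC s)%C) as [z [Hz0 [Hz1 Hmu]]].
    assert (Hlam : lam = (1 + RtoC s * RtoC s - RtoC s * (z + / z))%C).
    { rewrite <- Hmu.
      field. exact HsC. }
    destruct Hz1 as [Hz1 | Hz1].
    2:{ left. apply (unit_circle_segment s lam Hs). exists z. split; assumption. }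
    right. apply NNPP. intros Hno. revert Hspec.
    apply (resolvent_of_nonzero_boundary q (q * b) s m M A B z w T lam); try assumption.
    assert (Hone : forall u : C, (1 - u)%C = 0%C -> u = RtoC 1).
    { intros u Hu. transitivity (1 - (1 - u))%C; [ring | rewrite Hu; ring]. }
    intros n. split; intros Hzero; apply Hone in Hzero; apply Hno; [left | right]; exists n; split.
    + rewrite HXA. apply (Cmod_gt_1_of_product _ z Hz1). rewrite <- Hzero. ring.
    + rewrite Hlam. symmetry. apply first_family_point, Hzero.
    + rewrite HXB. apply (Cmod_gt_1_of_product _ z Hz1). rewrite <- Hzero. ring.
    + rewrite Hlam. symmetry. apply second_family_point, Hzero.
  - intros [Hseg | [[k [Hk ->]] | [l [Hl ->]]]].
    + destruct (proj2 (unit_circle_segment s lam Hs) Hseg) as [z [Hz Hlam]].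
      apply (spectrum_of_unit_circle q (q * b) s m M (A + B)%C z w T lam); assumption.
    + rewrite HXA in Hk. destruct (Cmod_inv_lt_1 _ Hk) as [HX [Hz0 Hz1]].
      assert (Hone : (A * / (A * RtoC (q ^ k)) * RtoC (q ^ k))%C = RtoC 1).
      { transitivity ((A * RtoC (q ^ k)) * / (A * RtoC (q ^ k)))%C; [ring | apply Cinv_r, HX]. }
      apply (eigenvalue_of_zero_boundary q (q * b) s m M A B _ w T _ k Hq Hp Hs Hw HAB HT Hz0 Hz1).
      * apply first_family_point, Hone.
      * left. rewrite Hone. ring.
    + rewrite HXB in Hl. destruct (Cmod_inv_lt_1 _ Hl) as [HX [Hz0 Hz1]].
      assert (Hone : (B * / (B * RtoC (q ^ l)) * RtoC (q ^ l))%C = RtoC 1).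
      { transitivity ((B * RtoC (q ^ l)) * / (B * RtoC (q ^ l)))%C; [ring | apply Cinv_r, HX]. }
      apply (eigenvalue_of_zero_boundary q (q * b) s m M A B _ w T _ l Hq Hp Hs Hw HAB HT Hz0 Hz1).
      * apply second_family_point, Hone.
      * right. rewrite Hone. ring.
Qed.

End Spectrum.

Theorem theorem4p1 (q a b : R) (c : cplx) :
  0 < q < 1 -> 0 < a < / q -> b < / q -> c <> c0 ->
  snd (gammaC a b q c) = 0 ->
  (forall n : nat, snd (LambdaC a b q c n) = 0 /\ 0 < fst (LambdaC a b q c n)) ->
  bounded_op (weight a b q) (Tgamma a b q (gammaC a b q c)) /\
  self_adjoint (weight a b q) (Tgamma a b q (gammaC a b q c)) /\
  simple_spectrum (weight a b q) (Tgamma a b q (gammaC a b q c)) /\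
  (forall lam : cplx,
     in_spectrum (weight a b q) (Tgamma a b q (gammaC a b q c)) lam <->
     spec_set a b q c lam).
Proof.
  intros Hq [Ha _] Hb Hc Hreal _.
  destruct (sqrt_params q a Hq Ha) as [Hs [_ [Hss _]]].
  assert (Hp : q * b < 1).
  { replace 1 with (q * / q) by (field; lra). apply Rmult_lt_compat_l; lra. }
  destruct (omega_bounds q (q * b) Hq Hp) as [m [M [Hm HM]]].
  assert (Hom : forall k, weight a b q k = omega q (q * b) k * (sqrt (a * q) ^ k) ^ 2)
    by (intros; apply weight_omega, Hss).
  assert (Hw : weight_comparable (weight a b q) (sqrt (a * q)) m M).
  { split; [exact Hm|]. intros k. rewrite Hom. specialize (HM k).
    split; apply Rmult_le_compat_r; try apply pow2_ge_0; lra. }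
  assert (Hg := gammaC_sum q a b c Hq Ha).
  set (sg := (RtoC (sqrt (a * q)) * c + RtoC (b * sqrt (q / a)) * / c)%C) in Hg.
  assert (HT : conjugate_to_Jop q (q * b) (sqrt (a * q)) sg (Tgamma a b q (gammaC a b q c)))
    by (apply Tgamma_conjugate; assumption).
  (* The imaginary part of [gamma] is [-s] times that of [sg], so real [gamma] makes the
     coefficients of [J] real even when [c] is not. *)
  assert (Hsg : Cconj sg = sg).
  { assert (H : snd sg = 0).
    { rewrite Hg in Hreal. unfold Cminus, Cplus, Copp, Cmult, RtoC in Hreal.
      cbn [fst snd] in Hreal. nra. }
    destruct sg as [x y]. simpl in H. subst y. unfold Cconj. simpl. f_equal. ring. }
  assert (Hbd := conjugate_bounded q (q * b) (sqrt (a * q)) m M sg _ _ Hq Hw HT).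
  split; [exact Hbd|]. split; [|split].
  - apply (conjugate_self_adjoint q (q * b) (sqrt (a * q)) sg); try assumption. apply Hbd.
  - apply Tgamma_simple_spectrum; [exact Hq|]. intros k. rewrite Hom.
    apply Rmult_le_pos; [specialize (HM k); lra | apply pow2_ge_0].
  - intros lam. apply (spectrum_eq q a b c Hq Ha Hb Hc _ _ m M lam Hw HT).
Qed.
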